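(* Let $(M_k)_{k\ge0}$ be an aperiodic irreducible Markov chain on a finite state space $S$, such that $M_0$ is distributed according to the stationary distribution $\pi$ of the chain. Let $\mathcal{L}=(u_1,\dots,u_d)$ be a $d$-tuple of finite words on the alphabet $S$, and let $X_N$ be the number of occurrences of $\mathcal{L}$ in the random word $W_N=(M_0,\dots,M_N)$. Let $\sigma(\mathcal{L})\ge0$ be the constant such that $\operatorname{Var}(X_N)=\sigma^2(\mathcal{L})\,N^{2d-1}\big(1+O(1/N)\big)$. Then, in distribution as $N\to\infty$, $$\widetilde{X_N}=\frac{X_N-\mathbb{E}(X_N)}{N^{d-1/2}}\to\mathcal{N}\big(0,\sigma^2(\mathcal{L})\big),$$ the limit being the (possibly degenerate, if $\sigma(\mathcal{L})=0$) centered Gaussian law with variance $\sigma^2(\mathcal{L})$.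
   Context: An occurrence of $\mathcal{L}=(u_1,\dots,u_d)$ in a word $w$ is a factorization $w=w_0u_1w_1\cdots u_dw_d$, where the $w_i$ are (possibly empty) words on the alphabet $S$; $X_N$ counts such factorizations of $W_N$. The constant $\sigma^2(\mathcal{L})$ depends on $\mathcal{L}$ and on the transition matrix of the chain; it is a known result of Bourdon and Vallée that such a constant exists, and $\sigma^2(\mathcal{L})=\lim_{N\to\infty}N^{-(2d-1)}\operatorname{Var}(X_N)$. *)

(* Defs.v *)
From mathcomp Require Import all_boot all_order all_algebra.
From mathcomp Require Import all_classical all_reals all_analysis.
Import Order.TTheory GRing.Theory Num.Theory.
Import numFieldNormedType.Exports.

Set Implicit Arguments.
Unset Strict Implicit.
Unset Printing Implicit Defensive.

Local Open Scope classical_set_scope.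
Local Open Scope ring_scope.

Section Words.
Variable S : finType.

Definition interleave (d : nat) (u : d.-tuple (seq S))
    (w0 : seq S) (w : d.-tuple (seq S)) : seq S :=
  w0 ++ flatten [seq uw.1 ++ uw.2 | uw <- zip u w].

(* In a factorization v = w_0 u_1 w_1 ... u_d w_d every w_i is at most as long
   as v, so counting tuples of words of length <= size v counts all the
   factorizations. *)
Definition occurrences (d : nat) (u : d.-tuple (seq S)) (v : seq S) : nat :=
  #|[set w : (size v).-bseq S * d.-tuple ((size v).-bseq S) |
      interleave u w.1 [tuple of map val w.2] == v]|%SET.

End Words.

Section TransitionMatrices.
Variables (R : realType) (S : finType).

Definition stochastic (p : S -> S -> R) : Prop :=
  (forall s t, 0 <= p s t) /\ (forall s, \sum_t p s t = 1).

Fixpoint nstep (p : S -> S -> R) (n : nat) (s t : S) : R :=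
  if n is m.+1 then \sum_r p s r * nstep p m r t else (s == t)%:R.

Definition irreducible (p : S -> S -> R) : Prop :=
  forall s t, exists n, 0 < nstep p n s t.

(* Every state has period 1, i.e., the return times of s have no common
   divisor other than 1. *)
Definition aperiodic (p : S -> S -> R) : Prop :=
  forall (s : S) (m : nat),
    (forall n, (0 < n)%N -> 0 < nstep p n s s -> (m %| n)%N) -> m = 1%N.

Definition stationary (p : S -> S -> R) (pi : S -> R) : Prop :=
  [/\ forall s, 0 <= pi s, \sum_s pi s = 1 &
      forall t, \sum_s pi s * p s t = pi t].

End TransitionMatrices.

Section MarkovChains.
Variables (R : realType) (S : finType).
Variables (disp : measure_display) (T : measurableType disp).
Variable P : probability T R.

Definition path_event (M : nat -> T -> S) (n : nat) (x : nat -> S) : set T :=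
  [set t | forall k, (k <= n)%N -> M k t = x k].

(* The last clause is
   P(M_(n+1) = x_(n+1) | M_0 = x_0, ..., M_n = x_n) = p(x_n, x_(n+1)),
   with the conditional probability multiplied out. *)
Definition markov_chain (p : S -> S -> R) (M : nat -> T -> S) : Prop :=
  [/\ stochastic p,
      forall k s, measurable (M k @^-1` [set s]) &
      forall n x, P (path_event M n.+1 x) =
                  (P (path_event M n x) * (p (x n) (x n.+1))%:E)%E].

Definition initial_law (pi : S -> R) (M : nat -> T -> S) : Prop :=
  forall s, P (M 0%N @^-1` [set s]) = (pi s)%:E.

(* The word (M_0, ..., M_N) has N + 1 letters. *)
Definition random_word (M : nat -> T -> S) (N : nat) (t : T) : seq S :=
  mkseq (fun k => M k t) N.+1.

Definition occ_count (M : nat -> T -> S) (d : nat) (u : d.-tuple (seq S))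
    (N : nat) (t : T) : R :=
  (occurrences u (random_word M N t))%:R.

(* Var(X_N) = sigma^2 N^(2d-1) (1 + O(1/N)), with the error term written as
   O(N^(2d-2)); for sigma = 0 it is this form, and not the factored one, which
   allows a variance that is of smaller order but nonzero. *)
Definition variance_asymptotics (M : nat -> T -> S) (d : nat)
    (u : d.-tuple (seq S)) (sigma : R) : Prop :=
  (fun N : nat => fine 'V_P[occ_count M u N]
      - sigma ^+ 2 * N%:R `^ (2 * d%:R - 1) : R^o)
  =O_\oo (fun N : nat => N%:R `^ (2 * d%:R - 2) : R^o).

Definition normalized_count (M : nat -> T -> S) (d : nat)
    (u : d.-tuple (seq S)) (N : nat) (t : T) : R :=
  (occ_count M u N t - fine 'E_P[occ_count M u N]) / N%:R `^ (d%:R - 2^-1).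

Definition cvg_in_distribution (Y : nat -> T -> R)
    (mu : probability (measurableTypeR R) R) : Prop :=
  forall f : R -> R, continuous f -> bounded_fun f ->
    'E_P[f \o Y N]%E @[N --> \oo] --> (\int[mu]_x (f x)%:E)%E.

End MarkovChains.

(* The normal_prob measure of standard deviation 0 is the uniform law on
   [0, 1], hence the case distinction. *)
Definition centered_gaussian (R : realType) (sigma : R) :
    probability (measurableTypeR R) R :=
  if sigma == 0 then (\d_(0 : measurableTypeR R) : probability _ R)
  else (normal_prob 0 sigma : probability _ R).

(* Main.v *)
(* The number of occurrences is a sum, over the d-tuples I of positions, of
   indicators that each read boundedly many letters of the word. The chain
   mixes exponentially fast, so the summand of I is almost independent of the
   part of the sum which reads only letters at distance more than ell = O(log N)
   from the letters read by I, and only O(ell N^(d-1)) summands are left out of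
   that part. Stein's argument for dependency graphs then gives, for the
   normalized count Y,
     E[Y f(Y)] - Var(Y) E[f'(Y)] -> 0   for f(y) = sin (t y + b),
   with no need for a Hoeffding decomposition nor for a formula for the
   variance. This says that c(t) = E[cos (t Y + b)] almost solves
   c' = - Var(Y) t c, whence the convergence of the characteristic function. As
   the variances are bounded, convergence in law follows by approximating a
   bounded continuous function with trigonometric polynomials on a compact
   interval. *)

Require Import Defs.
From mathcomp Require Import all_boot all_order all_algebra.
From mathcomp Require Import all_classical all_reals all_analysis.
From mathcomp Require Import measurable_realfun.
From mathcomp Require Import lra ring zify.
Import Order.TTheory GRing.Theory Num.Theory.
Import numFieldNormedType.Exports.

Set Implicit Arguments.
Unset Strict Implicit.
Unset Printing Implicit Defensive.

Local Open Scope classical_set_scope.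
Local Open Scope ring_scope.

(** * Stein's estimate on a finite probability space *)

(** Dependency-graph theorems usually divide by the standard deviation and need a lower bound for
    it. Here the normalization [N^(d-1/2)] is deterministic and the variance is only the coefficient
    of the differential equation, so a degenerate limit obeys the same estimates.

    The gap [ell] meets two opposite demands. In units of [N^(d-1/2)] there are about [sqrt N]
    summands, and a neighbourhood has size about [ell / sqrt N]. The Taylor remainders add up to
    [ell^2 / sqrt N], so [ell] must be [o(N^(1/4))]. The mixing error [e] gets multiplied by the
    square of [sqrt N], so [N e] must tend to 0. As [e] is exponentially small in [ell], a large
    multiple of [log N] serves.

    The rest of the sum reads letters before, between and after those of [I], so one use of the
    Markov property does not separate them. The chain is instead compared with two independent
    copies, one for each set of letters; the cost is counted by the passages from one set to the
    other, and the few letters read by [I] bound their number.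

    The phase [b] lets real cosines stand for complex exponentials. *)

Section FiniteExpectation.
Variables (R : realType) (Omega : finType) (w : Omega -> R).
Hypothesis w_ge0 : forall x, 0 <= w x.
Hypothesis w_sum1 : \sum_x w x = 1.

Definition wmean (F : Omega -> R) : R := \sum_x w x * F x.

Lemma eq_wmean F G : F =1 G -> wmean F = wmean G.
Proof. by move=> FG; apply: eq_bigr => x _; rewrite FG. Qed.

Lemma wmeanD F G : wmean (fun x => F x + G x) = wmean F + wmean G.
Proof. by rewrite -big_split; apply: eq_bigr => x _; rewrite mulrDr. Qed.

Lemma wmeanZl c F : wmean (fun x => c * F x) = c * wmean F.
Proof. by rewrite mulr_sumr; apply: eq_bigr => x _; rewrite mulrCA. Qed.

Lemma wmeanB F G : wmean (fun x => F x - G x) = wmean F - wmean G.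
Proof.
by rewrite -sumrB; apply: eq_bigr => x _; rewrite mulrBr.
Qed.

Lemma wmean_sum (J : finType) (Q : pred J) (F : J -> Omega -> R) :
  wmean (fun x => \sum_(j | Q j) F j x) = \sum_(j | Q j) wmean (F j).
Proof.
rewrite exchange_big /=; apply: eq_bigr => x _; exact: mulr_sumr.
Qed.

Lemma wmean_cst c : wmean (fun=> c) = c.
Proof. by rewrite /wmean -mulr_suml w_sum1 mul1r. Qed.

Lemma ler_wmean F G : (forall x, F x <= G x) -> wmean F <= wmean G.
Proof. by move=> FG; apply: ler_sum => x _; rewrite ler_wpM2l. Qed.

Lemma normr_wmean_le F c : (forall x, `|F x| <= c) -> `|wmean F| <= c.
Proof.
move=> Fc; apply: le_trans (ler_norm_sum _ _ _) _.
rewrite -[leRHS]wmean_cst; apply: ler_sum => x _.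
by rewrite normrM (ger0_norm (w_ge0 x)) ler_wpM2l.
Qed.

Lemma normr_wmeanB_le F G c :
  (forall x, `|F x - G x| <= c) -> `|wmean F - wmean G| <= c.
Proof. by move=> FG; rewrite -wmeanB; exact: normr_wmean_le. Qed.

(* [nb i] collects the indices whose summands may depend on the [i]-th one, [D]
   bounds their number, and [e] measures the remaining dependence. *)
Section SteinEstimate.
Variables (I : finType) (Z : I -> Omega -> R) (nb : I -> {set I}).
Variables (a D e : R).
Hypothesis Z_le1 : forall i x, `|Z i x| <= 1.
Hypothesis a_gt0 : 0 < a.
Hypothesis nb_le : forall i, #|nb i|%:R <= D.

Definition wsum_out (A : {set I}) (x : Omega) : R := (\sum_(i | i \notin A) Z i x) / a.

Hypothesis mix1 : forall i g B, (forall y, `|g y| <= B) ->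
  `|wmean (fun x => Z i x * g (wsum_out (nb i) x))| <= e * B.
Hypothesis mix2 : forall i j g B, (forall y, `|g y| <= B) ->
  `|wmean (fun x => Z i x * Z j x * g (wsum_out (nb i :|: nb j) x))
    - wmean (fun x => Z i x * Z j x) * wmean (fun x => g (wsum_out (nb i :|: nb j) x))|
  <= e * B.
Hypothesis mix3 : forall i j, j \notin nb i -> `|wmean (fun x => Z i x * Z j x)| <= e.

Variables (f f' : R -> R) (B0 B1 B2 : R).
Hypothesis f_le : forall y, `|f y| <= B0.
Hypothesis f'_le : forall y, `|f' y| <= B1.
Hypothesis f_taylor : forall y h, `|f (y + h) - f y - f' y * h| <= B2 * h ^+ 2.
Hypothesis f'_lip : forall y h, `|f' (y + h) - f' y| <= B2 * `|h|.

Local Notation Y := (wsum_out finset.set0).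

(** The index is a witness: for an empty [I] the mixing hypotheses do not determine the sign of
    [e]. *)
Let e_ge0 (i : I) : 0 <= e.
Proof.
have := @mix1 i (fun=> 0) 1 (fun y => _); rewrite mulr1 normr0.
by move=> /(_ (fun=> ler01)); apply: le_trans.
Qed.

Let B2_ge0 : 0 <= B2.
Proof. by have := f'_lip 0 1; rewrite normr1 mulr1; apply: le_trans. Qed.

Let D_ge0 (i : I) : 0 <= D.
Proof. exact: le_trans (nb_le i). Qed.

Let wsum_outB (A B : {set I}) x :
  A \subset B -> wsum_out A x = wsum_out B x + (\sum_(i in B :\: A) Z i x) / a.
Proof.
move=> AB; rewrite /wsum_out -mulrDl; congr (_ / a).
rewrite (bigID (mem B)) /= addrC; congr (_ + _); apply: eq_bigl => i.
  by case: (boolP (i \in B)) => iB; rewrite ?andbF ?andbT //; apply: contraNN iB; apply/fintype.subsetP.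
by rewrite inE.
Qed.

Let sum_Z_le (A : {set I}) x : `|\sum_(i in A) Z i x| <= #|A|%:R.
Proof.
apply: le_trans (ler_norm_sum _ _ _) _.
by rewrite -sum1_card natr_sum; apply: ler_sum => i _.
Qed.

Let part_le (A : {set I}) (c : R) x : #|A|%:R <= c ->
  `|(\sum_(i in A) Z i x) / a| <= c / a.
Proof.
move=> Ac; rewrite normrM normfV (gtr0_norm a_gt0) ler_pM2r ?invr_gt0 //.
exact: le_trans (sum_Z_le _ _) Ac.
Qed.

Let ZZ_le i j x : `|Z i x * Z j x| <= 1.
Proof. by rewrite normrM mulr_ile1. Qed.

(** The argument of [f'] is moved from the sum outside [nb i] to the sum outside [U], where [mix2]
    decouples it from the pair, and then to the whole sum. The two moves involve at most [D] and
    [2 D] summands, whence the factor 3. *)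
Let pair_term i j :
  `|wmean (fun x => Z i x * Z j x * f' (wsum_out (nb i) x))
    - wmean (fun x => Z i x * Z j x) * wmean (fun x => f' (Y x))|
  <= 3 * (B2 * (D / a)) + e * B1.
Proof.
set U := nb i :|: nb j.
have h1 : `|wmean (fun x => Z i x * Z j x * f' (wsum_out (nb i) x))
   - wmean (fun x => Z i x * Z j x * f' (wsum_out U x))| <= B2 * (D / a).
  apply: normr_wmeanB_le => x; rewrite -mulrBr normrM -[leRHS]mul1r.
  apply: ler_pM => //.
  rewrite (@wsum_outB (nb i) U) ?finset.subsetUl//.
  apply: le_trans (f'_lip _ _) _; apply: ler_wpM2l => //; apply: part_le.
  apply: le_trans (nb_le j); rewrite ler_nat subset_leq_card//.
  by apply/fintype.subsetP => k; rewrite !inE => /andP[/negPf->].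
have h2 := @mix2 i j f' B1 f'_le.
have h3 : `|wmean (fun x => f' (wsum_out U x)) - wmean (fun x => f' (Y x))|
    <= B2 * (2 * D / a).
  apply: normr_wmeanB_le => x; rewrite distrC (@wsum_outB finset.set0 U) ?finset.sub0set//.
  apply: le_trans (f'_lip _ _) _; apply: ler_wpM2l => //; apply: part_le.
  rewrite finset.setD0 mulr_natl mulr2n.
  apply: le_trans (lerD (nb_le i) (nb_le j)).
  by rewrite -natrD ler_nat cardsU leq_subr.
have h4 : `|wmean (fun x => Z i x * Z j x)| <= 1 by exact/normr_wmean_le/ZZ_le.
set p1 := wmean _ in h1 *; set p2 := wmean _ in h1; set q := wmean _ in h4 *.
rewrite -/U in h2; set r := wmean (fun x => f' (wsum_out U x)) in h2 h3.
set s := wmean _ in h3 *; rewrite -/p2 -/q -/r in h2.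
have -> : p1 - q * s = (p1 - p2) + (p2 - q * r) + q * (r - s) by ring.
apply: le_trans (ler_normD _ _) _; apply: le_trans (lerD (ler_normD _ _) (lexx _)) _.
have : `|q * (r - s)| <= B2 * (2 * D / a).
  by rewrite normrM -[leRHS]mul1r ler_pM.
have -> : B2 * (2 * D / a) = 2 * (B2 * (D / a)) by ring.
lra.
Qed.

(** Taylor expansion of [f] at the sum [W] outside [nb i]: the constant term is small by [mix1], the
    linear term is a sum of pairs, and [mix3] supplies the covariances with indices outside [nb i].
    The factor 4 is 1 for the Taylor remainder plus 3 from [pair_term]. *)
Let single_term i :
  `|wmean (fun x => Z i x * f (Y x))
    - (\sum_j wmean (fun x => Z i x * Z j x)) / a * wmean (fun x => f' (Y x))|
  <= e * B0 + 4 * B2 * (D / a) ^+ 2 + (D / a) * (e * B1) + #|I|%:R / a * (e * B1).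
Proof.
pose W := wsum_out (nb i); pose V x := (\sum_(j in nb i) Z j x) / a.
have YE x : Y x = W x + V x by rewrite (@wsum_outB finset.set0 (nb i)) ?finset.sub0set// finset.setD0.
have Da0 : 0 <= D / a by rewrite divr_ge0 ?(D_ge0 i) ?ltW.
have h1 : `|wmean (fun x => Z i x * f (Y x)) -
   wmean (fun x => Z i x * f (W x) + Z i x * f' (W x) * V x)| <= B2 * (D / a) ^+ 2.
  apply: normr_wmeanB_le => x; rewrite YE.
  have -> : Z i x * f (W x + V x) - (Z i x * f (W x) + Z i x * f' (W x) * V x) =
    Z i x * (f (W x + V x) - f (W x) - f' (W x) * V x) by ring.
  rewrite normrM -[leRHS]mul1r; apply: ler_pM => //.
  apply: le_trans (f_taylor _ _) _; apply: ler_wpM2l => //.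
  rewrite -[V x ^+ 2]ger0_norm ?sqr_ge0// normrX lerXn2r ?nnegrE//.
  by apply: part_le; exact: nb_le.
have h2 := @mix1 i f B0 f_le; rewrite -/W in h2.
rewrite wmeanD in h1.
have h3 : wmean (fun x => Z i x * f' (W x) * V x) =
   (\sum_(j in nb i) wmean (fun x => Z i x * Z j x * f' (W x))) / a.
  rewrite -wmean_sum mulrC -wmeanZl; apply: eq_wmean => x.
  rewrite /V mulrA mulr_sumr mulrC; congr (_ * _); apply: eq_bigr => j _.
  by rewrite mulrAC.
set m' := wmean (fun x => f' (Y x)).
have m'_le : `|m'| <= B1 by apply: normr_wmean_le => x; exact: f'_le.
have h4 : `|(\sum_(j in nb i) wmean (fun x => Z i x * Z j x * f' (W x))) / a
     - (\sum_(j in nb i) wmean (fun x => Z i x * Z j x)) / a * m'|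
    <= (D / a) * (3 * (B2 * (D / a)) + e * B1).
  rewrite mulrAC -mulrBl normrM normfV (gtr0_norm a_gt0) mulrAC.
  rewrite ler_pM2r ?invr_gt0// mulr_suml -sumrB.
  apply: le_trans (ler_norm_sum _ _ _) _.
  apply: le_trans (ler_sum _ (fun j _ => pair_term i j)) _.
  rewrite sumr_const -[leLHS]mulr_natl ler_wpM2r//.
  exact: le_trans (pair_term i i).
have h5 : `|(\sum_(j | j \notin nb i) wmean (fun x => Z i x * Z j x)) / a * m'|
    <= #|I|%:R / a * (e * B1).
  have le_ne : `|\sum_(j | j \notin nb i) wmean (fun x => Z i x * Z j x)| <= #|I|%:R * e.
    apply: le_trans (ler_norm_sum _ _ _) _.
    apply: le_trans (ler_sum _ (fun j Hj => mix3 Hj)) _.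
    rewrite sumr_const -[leLHS]mulr_natl. rewrite ler_wpM2r ?(e_ge0 i) ?ler_nat ?max_card//.
  rewrite !normrM normfV (gtr0_norm a_gt0).
  have -> : #|I|%:R / a * (e * B1) = #|I|%:R * e / a * B1 by ring.
  by apply: ler_pM => //; rewrite ?divr_ge0 ?(ltW a_gt0)// ler_pM2r ?invr_gt0.
have -> : \sum_j wmean (fun x => Z i x * Z j x) =
  \sum_(j in nb i) wmean (fun x => Z i x * Z j x)
   + \sum_(j | j \notin nb i) wmean (fun x => Z i x * Z j x).
  by rewrite (bigID (mem (nb i))).
rewrite h3 in h1.
move: h1 h2 h4 h5; rewrite -/m'.
set q1 := wmean (fun x => Z i x * f (Y x)); set q2 := wmean _.
set s1 := (\sum_(j in nb i) _) / a.
set t1 := \sum_(j in nb i) _; set t2 := \sum_(j | _) _ => h1 h2 h4 h5.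
rewrite !ler_norml in h1 h2 h4 h5 *.
have -> : (t1 + t2) / a * m' = t1 / a * m' + t2 / a * m' by ring.
lra.
Qed.

Lemma stein_estimate :
  `|wmean (fun x => Y x * f (Y x)) - wmean (fun x => Y x ^+ 2) * wmean (fun x => f' (Y x))|
  <= #|I|%:R / a *
     (e * B0 + 4 * B2 * (D / a) ^+ 2 + (D / a) * (e * B1) + #|I|%:R / a * (e * B1)).
Proof.
have YE x : Y x = a^-1 * \sum_i Z i x.
  by rewrite /wsum_out mulrC; congr (_ * _); apply: eq_bigl => i; rewrite inE.
have -> : wmean (fun x => Y x * f (Y x)) = a^-1 * \sum_i wmean (fun x => Z i x * f (Y x)).
  rewrite -wmean_sum -wmeanZl; apply: eq_wmean => x.
  by rewrite {1}YE -mulrA mulr_suml.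
have -> : wmean (fun x => Y x ^+ 2) =
    a^-1 * \sum_i (\sum_j wmean (fun x => Z i x * Z j x)) / a.
  transitivity (a^-1 * (a^-1 * wmean (fun x => \sum_i \sum_j Z i x * Z j x))).
    rewrite -!wmeanZl; apply: eq_wmean => x; rewrite YE expr2 -!mulrA; congr (_ * _).
    rewrite mulrCA; congr (_ * _); rewrite mulr_suml; apply: eq_bigr => i _.
    exact: mulr_sumr.
  congr (_ * _); rewrite wmean_sum mulr_sumr; apply: eq_bigr => i _.
  by rewrite wmean_sum mulrC.
rewrite -[X in `|_ - X|]mulrA -mulrBr normrM normfV (gtr0_norm a_gt0) mulrAC [leRHS]mulrC.
rewrite ler_pM2l ?invr_gt0// mulr_suml -sumrB.
apply: le_trans (ler_norm_sum _ _ _) _.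
apply: le_trans (ler_sum _ (fun i _ => single_term i)) _.
by rewrite sumr_const -[leLHS]mulr_natl.
Qed.

End SteinEstimate.
End FiniteExpectation.

(** * Mixing of a finite chain *)

Section ChainMeans.
Variables (R : realType) (S : finType) (p : S -> S -> R).
Hypothesis p_stoch : stochastic p.

Definition distr (mu : S -> R) : Prop := (forall s, 0 <= mu s) /\ \sum_s mu s = 1.

Definition push (mu : S -> R) (t : S) : R := \sum_s mu s * p s t.

Definition dist1 (mu nu : S -> R) : R := \sum_s `|mu s - nu s|.

Lemma distr_kernel s : distr (p s).
Proof. by split=> [t|]; [exact: p_stoch.1|exact: p_stoch.2]. Qed.

Lemma distr_push mu : distr mu -> distr (push mu).
Proof.
move=> [mu0 mu1]; split=> [t|].
  by apply: sumr_ge0 => s _; rewrite mulr_ge0// p_stoch.1.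
rewrite exchange_big /= -mu1; apply: eq_bigr => s _.
by rewrite -mulr_sumr p_stoch.2 mulr1.
Qed.

Lemma distr_iter_push g mu : distr mu -> distr (iter g push mu).
Proof. by move=> mu_d; elim: g => //= g; exact: distr_push. Qed.

Fixpoint path_weight (mu : S -> R) (l : seq S) : R :=
  if l is s :: l' then mu s * path_weight (p s) l' else 1.

Lemma path_weight_ge0 mu l : distr mu -> 0 <= path_weight mu l.
Proof.
elim: l mu => [|s l IH] mu mu_d //=; rewrite mulr_ge0 ?mu_d.1//.
exact/IH/distr_kernel.
Qed.

Definition chain_mean (mu : S -> R) (n : nat) (F : seq S -> R) : R :=
  wmean (fun x : n.-tuple S => path_weight mu x) F.

Lemma eq_chain_mean mu n F G : (forall x, size x = n -> F x = G x) ->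
  chain_mean mu n F = chain_mean mu n G.
Proof. by move=> FG; apply: eq_wmean => x; rewrite FG ?size_tuple. Qed.

Lemma chain_mean0 mu F : chain_mean mu 0 F = F [::].
Proof.
rewrite /chain_mean /wmean (bigD1 [tuple]) //= big1 ?addr0 ?mul1r// => x.
by move/eqP => xN; case: xN; exact: tuple0.
Qed.

Lemma chain_meanS mu n F :
  chain_mean mu n.+1 F = \sum_s mu s * chain_mean (p s) n (fun l => F (s :: l)).
Proof.
rewrite /chain_mean /wmean.
rewrite (reindex (fun sx : S * n.-tuple S => [tuple of sx.1 :: sx.2])) /=; last first.
  exists (fun x : n.+1.-tuple S => (thead x, [tuple of behead x])).
    by move=> [s x] _ /=; congr (_, _); apply: val_inj.
  by move=> x _; rewrite /= [RHS]tuple_eta.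
under [RHS]eq_bigr do rewrite mulr_sumr.
by rewrite pair_big /=; apply: eq_bigr => -[s x] _ /=; rewrite mulrA.
Qed.

Lemma chain_mean_cst mu n c : distr mu -> chain_mean mu n (fun=> c) = c.
Proof.
elim: n mu => [|n IH] mu mu_d; first by rewrite chain_mean0.
rewrite chain_meanS -[RHS]mul1r -mu_d.2 mulr_suml; apply: eq_bigr => s _.
by rewrite IH//; exact: distr_kernel.
Qed.

Lemma sum_path_weight mu n : distr mu -> \sum_(x : n.-tuple S) path_weight mu x = 1.
Proof.
move=> mu_d; rewrite -[RHS](chain_mean_cst n 1 mu_d).
by apply: eq_bigr => x _; rewrite mulr1.
Qed.

Lemma chain_meanZl mu n c F :
  chain_mean mu n (fun x => c * F x) = c * chain_mean mu n F.
Proof. exact: wmeanZl. Qed.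

Lemma chain_mean_sum mu n (J : finType) (F : J -> seq S -> R) :
  chain_mean mu n (fun x => \sum_j F j x) = \sum_j chain_mean mu n (F j).
Proof. exact: wmean_sum. Qed.

Lemma normr_chain_mean_le mu n F c : distr mu -> (forall x, `|F x| <= c) ->
  `|chain_mean mu n F| <= c.
Proof.
move=> mu_d Fc; apply: normr_wmean_le => // [x|]; first exact: path_weight_ge0.
exact: sum_path_weight.
Qed.

(** Forgetting the value of a letter amounts to moving the law of the next one a step ahead. *)
Lemma chain_mean_push mu n F : distr mu ->
  \sum_s mu s * chain_mean (p s) n F = chain_mean (push mu) n F.
Proof.
move=> mu_d; case: n => [|n].
  by under eq_bigr do rewrite chain_mean0; rewrite chain_mean0 -mulr_suml mu_d.2 mul1r.
under eq_bigr do rewrite chain_meanS mulr_sumr.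
rewrite exchange_big /= chain_meanS; apply: eq_bigr => t _.
by rewrite mulr_suml; apply: eq_bigr => s _; rewrite mulrA.
Qed.

Lemma chain_mean_exchange mu nu n m (F : seq S -> seq S -> R) :
  chain_mean mu n (fun x => chain_mean nu m (F x)) =
  chain_mean nu m (fun y => chain_mean mu n (F ^~ y)).
Proof.
rewrite /chain_mean /wmean; under eq_bigr do rewrite mulr_sumr.
rewrite exchange_big /=; apply: eq_bigr => y _.
by rewrite mulr_sumr; apply: eq_bigr => x _; rewrite mulrCA.
Qed.

(* Positions labelled [Some b] are read from the first word, those labelled
   [Some (~~ b)] from the second one, and the others are erased. *)
Fixpoint merge (s0 : S) (b : bool) (L : seq (option bool)) (x y : seq S) : seq S :=
  match L, x, y with
  | o :: L', s :: x', t :: y' =>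
    (if o is Some b' then if b' == b then s else t else s0) :: merge s0 b L' x' y'
  | _, _, _ => [::]
  end.

Lemma merge_sym s0 b L x y : merge s0 b L x y = merge s0 (~~ b) L y x.
Proof.
elim: L x y => [|o L IH] [|s x] [|t y] //=; rewrite IH; congr (_ :: _).
by case: o => // -[]; case: b {IH}.
Qed.

Lemma size_merge s0 b L x y : size x = size L -> size y = size L ->
  size (merge s0 b L x y) = size L.
Proof. by elim: L x y => [|o L IH] [|s x] [|t y] //= [xL] [yL]; rewrite IH. Qed.

Lemma nth_merge s0 b L x y k : size x = size L -> size y = size L ->
  nth s0 (merge s0 b L x y) k =
  if nth None L k is Some b' then if b' == b then nth s0 x k else nth s0 y k else s0.
Proof.
elim: L x y k => [|o L IH] [|s x] [|t y] [|k] //= [xL] [yL].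
exact: IH.
Qed.

(* [g] is the number of unlabelled positions read since the last labelled one,
   whose label was [Some b]. *)
Fixpoint separated (ell : nat) (b : bool) (g : nat) (L : seq (option bool)) : bool :=
  match L with
  | [::] => true
  | None :: L' => separated ell b g.+1 L'
  | Some b' :: L' => ((b' == b) || (ell <= g)%N) && separated ell b' 0 L'
  end.

Fixpoint switches (b : bool) (L : seq (option bool)) : nat :=
  match L with
  | [::] => 0
  | None :: L' => switches b L'
  | Some b' :: L' => (b' != b) + switches b' L'
  end.

(** Every run of [Some true] is entered and left at most once; starting in state [true] allows one
    more exit. Only one label is counted, so the other may occur arbitrarily often. *)
Lemma switches_le b L : (switches b L <= (count_mem (Some true) L).*2 + b)%N.
Proof.
elim: L b => [|[[]|] L IH] b //=; first by have := IH true; case: b => /= *; lia.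
by have := IH false; case: b => /= *; lia.
Qed.

Lemma separated_nth ell b g L :
  (forall k b', nth None L k = Some b' -> b' != b -> (ell <= g + k)%N) ->
  (forall j k b' b'', (j < k)%N -> nth None L j = Some b' -> nth None L k = Some b'' ->
     b'' != b' -> (j + ell < k)%N) ->
  separated ell b g L.
Proof.
elim: L b g => [|o L IH] b g //= hfst hpair.
have hpair' j k b' b'' : (j < k)%N -> nth None L j = Some b' -> nth None L k = Some b'' ->
     b'' != b' -> (j + ell < k)%N.
  by move=> jk Lj Lk bb; have := hpair j.+1 k.+1 b' b'' jk Lj Lk bb; rewrite addSn.
case: o hfst hpair => [b'|] hfst hpair.
  apply/andP; split.
    by case: eqP => //= /eqP bb; have := hfst 0%N b' erefl bb; rewrite addn0.
  apply: IH => // k b'' Lk bb; rewrite add0n.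
  by have := hpair 0%N k.+1 b' b'' isT erefl Lk bb; rewrite add0n ltnS.
apply: IH => // k b' Lk bb.
by have := hfst k.+1 b' Lk bb; rewrite addnS addSn.
Qed.

Section Mixing.
Variables (ell : nat) (delta : R).
Hypothesis contraction : forall g mu nu, (ell <= g)%N -> distr mu -> distr nu ->
  dist1 (iter g push mu) (iter g push nu) <= delta.

Lemma delta_ge0 mu : distr mu -> 0 <= delta.
Proof.
move=> mu_d; apply: le_trans (contraction (leqnn ell) mu_d mu_d).
by apply: sumr_ge0.
Qed.

(* Induction on the labels. Each time the label changes, the next letter is
   drawn from the law of the other chain; after [ell] unlabelled steps the two
   laws differ by at most [delta]. *)
Lemma chain_mean_merge s0 L b g mu nu (K : seq S -> R) (B : R) :
  (forall x, `|K x| <= B) -> distr mu -> distr nu -> separated ell b g L ->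
  `|chain_mean (iter g push mu) (size L) (fun x => K (merge s0 b L x x))
    - chain_mean (iter g push mu) (size L) (fun x =>
        chain_mean (iter g push nu) (size L) (fun y => K (merge s0 b L x y)))|
  <= delta * B * (switches b L)%:R.
Proof.
elim: L b g mu nu K => [|o L IH] b g mu nu K KB mu_d nu_d sep.
  by rewrite !chain_mean0 subrr normr0 mulr0.
have B0 : 0 <= B by exact: le_trans (KB [::]).
have d0 := delta_ge0 mu_d.
have mug := distr_iter_push g mu_d; have nug := distr_iter_push g nu_d.
(* An erased letter costs nothing: both laws advance by one step and the gap grows. *)
rewrite [size _]/=; case: o sep => [b'|] sep; last first.
  rewrite [switches _ _]/=.
  pose K' l := K (s0 :: l).
  have -> : chain_mean (iter g push mu) (size L).+1 (fun x =>
       K (merge s0 b (None :: L) x x)) =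
     chain_mean (iter g.+1 push mu) (size L) (fun x => K' (merge s0 b L x x)).
    by rewrite chain_meanS /= chain_mean_push.
  have -> : chain_mean (iter g push mu) (size L).+1 (fun x =>
       chain_mean (iter g push nu) (size L).+1 (fun y => K (merge s0 b (None :: L) x y))) =
     chain_mean (iter g.+1 push mu) (size L) (fun x =>
       chain_mean (iter g.+1 push nu) (size L) (fun y => K' (merge s0 b L x y))).
    rewrite chain_meanS -chain_mean_push //; apply: eq_bigr => s _; congr (_ * _).
    by apply: eq_chain_mean => x _; rewrite chain_meanS /= chain_mean_push.
  by apply: IH => // x; exact: KB.
(* Same label: in both means the letter is drawn from the first chain, which restarts from [p s]
   with gap 0, while the unread chain advances by one step. *)
have [bb|bb] := eqVneq b' b.
  move: sep; rewrite bb [separated _ _ _ _]/= [switches _ _]/= eqxx add0n => sep.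
  have -> : chain_mean (iter g push mu) (size L).+1 (fun x =>
       chain_mean (iter g push nu) (size L).+1 (fun y => K (merge s0 b (Some b :: L) x y))) =
     \sum_s iter g push mu s * chain_mean (p s) (size L) (fun x =>
       chain_mean (iter g.+1 push nu) (size L) (fun y => K (s :: merge s0 b L x y))).
    rewrite chain_meanS; apply: eq_bigr => s _; congr (_ * _).
    by apply: eq_chain_mean => x _; rewrite chain_meanS /= eqxx chain_mean_push.
  rewrite chain_meanS -sumrB; apply: le_trans (ler_norm_sum _ _ _) _.
  rewrite -[leRHS]mul1r -{1}mug.2 mulr_suml; apply: ler_sum => s _.
  rewrite -mulrBr normrM (ger0_norm (mug.1 s)) ler_wpM2l ?mug.1//= eqxx.
  apply: (IH b 0%N (p s) (iter g.+1 push nu) (fun l => K (s :: l))) => //.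
  - exact: distr_kernel.
- exact: distr_iter_push.
move: sep; rewrite [separated _ _ _ _]/= [switches _ _]/= (negPf bb) => /andP[ell_g sep].
have b'E : b' = ~~ b by case: b b' bb {sep} => -[].
(* After a switch the words exchange roles: the second chain continues from the letter [s] just
   read, and the first becomes the one in reserve. *)
pose J s := chain_mean (p s) (size L) (fun l => K (s :: merge s0 b' L l l)).
pose D s := chain_mean (p s) (size L) (fun y =>
  chain_mean (iter g.+1 push mu) (size L) (fun x => K (s :: merge s0 b' L y x))).
have -> : chain_mean (iter g push mu) (size L).+1 (fun x =>
     K (merge s0 b (Some b' :: L) x x)) = \sum_s iter g push mu s * J s.
  rewrite chain_meanS; apply: eq_bigr => s _; congr (_ * _).
  by apply: eq_chain_mean => x _ /=; rewrite merge_sym -b'E; case: ifP.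
have -> : chain_mean (iter g push mu) (size L).+1 (fun x =>
     chain_mean (iter g push nu) (size L).+1 (fun y => K (merge s0 b (Some b' :: L) x y))) =
   \sum_s iter g push nu s * D s.
  rewrite chain_mean_exchange chain_meanS; apply: eq_bigr => s _; congr (_ * _).
  apply: eq_chain_mean => y _; rewrite chain_meanS /= (negPf bb) chain_mean_push//.
  by apply: eq_chain_mean => x _; rewrite merge_sym -b'E.
(* The first sum pays [delta * B] for the change of law of [s]; the second is left to the
   induction. *)
have -> : \sum_s iter g push mu s * J s - \sum_s iter g push nu s * D s =
  \sum_s (iter g push mu s - iter g push nu s) * J s
   + \sum_s iter g push nu s * (J s - D s).
  by rewrite -sumrB -big_split; apply: eq_bigr => s _ /=; ring.
rewrite natrD mulrDr mulr1; apply: le_trans (ler_normD _ _) _; apply: lerD.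
  apply: le_trans (ler_norm_sum _ _ _) _.
  apply: (@le_trans _ _ (dist1 (iter g push mu) (iter g push nu) * B)).
    rewrite mulr_suml; apply: ler_sum => s _; rewrite normrM ler_wpM2l//.
    by apply: normr_chain_mean_le => //; exact: distr_kernel.
  by rewrite ler_wpM2r// contraction.
apply: le_trans (ler_norm_sum _ _ _) _.
rewrite -[leRHS]mul1r -{1}nug.2 mulr_suml; apply: ler_sum => s _.
rewrite normrM (ger0_norm (nug.1 s)) ler_wpM2l ?nug.1//.
apply: (IH b' 0%N (p s) (iter g.+1 push mu) (fun l => K (s :: l))) => //.
- exact: distr_kernel.
- exact: distr_iter_push.
Qed.

Definition reads_only (n : nat) (A : pred nat) (F : seq S -> R) : Prop :=
  forall s0 x y, size x = n -> size y = n ->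
    (forall k, A k -> nth s0 x k = nth s0 y k) -> F x = F y.

(** With the positions of [A] and [B] labelled differently, [F] sees only the second word of the
    merge and [G] only the first, so the mean over two words factorizes. The cost counts the
    positions of [A] alone: [G] may read almost the whole word. *)
Lemma chain_mean_mixing (s0 : S) mu n (A B : pred nat) (m : nat) F G cF cG :
  distr mu -> push mu =1 mu ->
  reads_only n A F -> reads_only n B G ->
  (forall x, `|F x| <= cF) -> (forall x, `|G x| <= cG) ->
  (forall j k, A j -> B k -> (j + ell < k)%N || (k + ell < j)%N) ->
  (count A (iota 0 n) <= m)%N ->
  `|chain_mean mu n (fun x => F x * G x) - chain_mean mu n F * chain_mean mu n G|
   <= delta * (cF * cG) * m.*2%:R.
Proof.
move=> mu_d mu_inv FA GB FcF GcG AB Am.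
pose lab k := if A k then Some true else if B k then Some false else None.
pose L := mkseq lab n.
have sL : size L = n by rewrite size_mkseq.
have labN k : nth None L k = if (k < n)%N then lab k else None.
  by case: ltnP => kn; [rewrite nth_mkseq|rewrite nth_default ?sL].
have labT k : nth None L k = Some true -> A k.
  by rewrite labN /lab; case: ifP => // _; case: ifP => //; case: ifP.
have labF k : nth None L k = Some false -> B k.
  by rewrite labN /lab; case: ifP => // _; case: ifP => //; case: ifP.
(* Starting with gap [ell] leaves the first label unconstrained. It is free of charge because [mu]
   is invariant under [push]. *)
have sep : separated ell false ell L.
  apply: separated_nth => [k b' _ _|j k b' b'' jk Lj Lk bb]; first exact: leq_addr.
  have : (j + ell < k)%N || (k + ell < j)%N.
    case: b' b'' Lj Lk bb => -[] // /[swap].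
      by move=> /labF Bk /labT Aj _; exact: AB.
    by move=> /labT Ak /labF Bj _; rewrite orbC; exact: AB.
  by case/orP => // ?; lia.
have iterE g : iter g push mu = mu.
  by elim: g => //= g ->; apply/funext.
have FM x y : size x = n -> size y = n -> F (merge s0 false L x y) = F y.
  move=> xn yn; apply: (FA s0) => //; first by rewrite size_merge ?sL.
  move=> k Ak; rewrite nth_merge ?sL// labN /lab Ak.
  by case: ltnP => // kn; rewrite nth_default ?yn.
have GM x y : size x = n -> size y = n -> G (merge s0 false L x y) = G x.
  move=> xn yn; apply: (GB s0) => //; first by rewrite size_merge ?sL.
  move=> k Bk; rewrite nth_merge ?sL// labN /lab Bk.
  case: ltnP => [kn|kn]; last by rewrite nth_default ?xn.
  by case: ifP => // Ak; have := AB k k Ak Bk; lia.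
have := @chain_mean_merge s0 L false ell mu mu (fun x => F x * G x) (cF * cG) _ mu_d mu_d sep.
rewrite sL iterE.
have -> : chain_mean mu n (fun x => F (merge s0 false L x x) * G (merge s0 false L x x))
    = chain_mean mu n (fun x => F x * G x).
  by apply: eq_chain_mean => x xn; rewrite FM ?GM.
have -> : chain_mean mu n (fun x => chain_mean mu n (fun y =>
      F (merge s0 false L x y) * G (merge s0 false L x y))) =
    chain_mean mu n F * chain_mean mu n G.
  rewrite -chain_meanZl; apply: eq_chain_mean => x xn.
  rewrite mulrC -chain_meanZl; apply: eq_chain_mean => y yn.
  by rewrite FM ?GM// mulrC.
move=> /(_ _) h; apply: le_trans (h _) _.
  by move=> x; rewrite normrM ler_pM.
have cFG0 : 0 <= cF * cG.
  by rewrite mulr_ge0 ?(le_trans _ (FcF [::])) ?(le_trans _ (GcG [::])).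
apply: ler_wpM2l; first by rewrite mulr_ge0 ?(delta_ge0 mu_d).
rewrite ler_nat.
apply: leq_trans (switches_le _ _) _; rewrite addn0 leq_double.
apply: leq_trans Am; rewrite count_map; apply: sub_count => k /=.
by rewrite /lab; case: ifP => // _; case: ifP.
Qed.

End Mixing.
End ChainMeans.

(** The least difference [d > 0] between two elements divides every element, since a nonzero
    remainder would be a smaller difference; hence [d = 1]. Once [a] and [a + 1] are elements, so is
    each [n = q a + r = (q - r) a + r (a + 1)] with [r <= q], which covers all [n >= a * a]. *)
Lemma numerical_semigroup_cofinite (G : nat -> Prop) :
  G 0%N -> (forall m n, G m -> G n -> G (m + n)%N) ->
  (forall m, (forall n, (0 < n)%N -> G n -> (m %| n)%N) -> m = 1%N) ->
  exists N, forall n, (N <= n)%N -> G n.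
Proof.
move=> G0 GD Ggcd.
have GM q n : G n -> G (q * n)%N.
  by move=> Gn; elim: q => [|q IH]; rewrite ?mul0n// mulSn; exact: GD.
pose gap d := `[< (0 < d)%N /\ exists a, G a /\ G (a + d)%N >].
have ex_gap : exists d, gap d.
  (* Without any gap there is no positive element, and 2 would divide them all vacuously. *)
  apply: contrapT => nogap; suff : 2%N = 1%N by [].
  apply: Ggcd => n n0 Gn; exfalso; apply: nogap; exists n.
  by apply/asboolP; split => //; exists 0%N.
case: (ex_minnP ex_gap) => d /asboolP[d0 [a [Ga Gad]]] d_min.
have d1 : d = 1%N.
  apply: Ggcd => n _ Gn; rewrite /dvdn; apply: contrapT => /negP; rewrite -lt0n => r0.
  suff /d_min : gap (n %% d)%N by rewrite leqNgt ltn_mod d0.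
  apply/asboolP; split => //; exists (n %/ d * (a + d))%N; split; first exact: GM.
  have -> : (n %/ d * (a + d) + n %% d = n %/ d * a + n)%N.
    by rewrite mulnDr -addnA -divn_eq.
  by apply: GD => //; exact: GM.
rewrite {}d1 addn1 in Gad; exists (a * a)%N => n an.
case: a Ga Gad an => [|a] Ga Gad an; first by rewrite -[n]muln1; exact: GM.
have q_ge : (n %% a.+1 <= n %/ a.+1)%N.
  apply: leq_trans (ltnW (ltn_pmod n (ltn0Sn a))) _.
  by rewrite leq_divRL.
have -> : n = ((n %/ a.+1 - n %% a.+1) * a.+1 + n %% a.+1 * a.+2)%N.
  rewrite {1}(divn_eq n a.+1) -{1}(subnK q_ge) mulnDl -addnA; congr (_ + _)%N.
  by rewrite [RHS]mulnS addnC.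
by apply: GD; exact: GM.
Qed.

(** * Loss of memory of an irreducible aperiodic chain *)

Section Ergodicity.
Variables (R : realType) (S : finType) (p : S -> S -> R).
Hypothesis p_stoch : stochastic p.

Lemma nstep_ge0 n s t : 0 <= nstep p n s t.
Proof.
elim: n s => [|n IH] s /=; first exact: ler0n.
by apply: sumr_ge0 => r _; rewrite mulr_ge0// p_stoch.1.
Qed.

Lemma sum_nstep n s : \sum_t nstep p n s t = 1.
Proof.
elim: n s => [|n IH] s /=.
  by rewrite (bigD1 s)//= eqxx big1 ?addr0// => t /negPf; rewrite eq_sym => ->.
rewrite exchange_big /= -(p_stoch.2 s); apply: eq_bigr => r _.
by rewrite -mulr_sumr IH mulr1.
Qed.

Lemma nstepD m n s t : nstep p (m + n) s t = \sum_r nstep p m s r * nstep p n r t.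
Proof.
elim: m s => [|m IH] s /=.
  rewrite (bigD1 s)//= eqxx mul1r big1 ?addr0// => r /negPf.
  by rewrite eq_sym => ->; rewrite mul0r.
under eq_bigr do rewrite IH mulr_sumr.
rewrite exchange_big /=; apply: eq_bigr => r _; rewrite mulr_suml.
by apply: eq_bigr => r' _; rewrite mulrA.
Qed.

Lemma nstepD_gt0 m n s r t :
  0 < nstep p m s r -> 0 < nstep p n r t -> 0 < nstep p (m + n) s t.
Proof.
move=> m0 n0; rewrite nstepD (bigD1 r)//=; apply: ltr_pwDl; first exact: mulr_gt0.
by apply: sumr_ge0 => r' _; rewrite mulr_ge0// nstep_ge0.
Qed.

Lemma iter_push_nstep g mu t : iter g (push p) mu t = \sum_s mu s * nstep p g s t.
Proof.
elim: g mu => [|g IH] mu.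
  by rewrite /= (bigD1 t)//= eqxx mulr1 big1 ?addr0// => s /negPf ->; rewrite mulr0.
rewrite iterSr IH /push /=.
under eq_bigr do rewrite mulr_suml.
rewrite exchange_big /=; apply: eq_bigr => r _; rewrite mulr_sumr.
by apply: eq_bigr => s _; rewrite mulrA.
Qed.

Hypothesis p_irr : irreducible p.
Hypothesis p_aper : aperiodic p.

(** The possible return times to [s] form an additive semigroup, so all large times occur; a fixed
    path from [s] to [t] carries this over to the pair, and there are finitely many pairs. *)
Lemma nstep_eventually_gt0 : exists N, forall s t, 0 < nstep p N s t.
Proof.
have ev s t : exists N, forall n, (N <= n)%N -> 0 < nstep p n s t.
  have [|m n||N hN] := @numerical_semigroup_cofinite (fun n => 0 < nstep p n s s).
  - by rewrite /= eqxx.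
  - exact: nstepD_gt0.
  - exact: p_aper.
  have [k k0] := p_irr s t; exists (N + k)%N => n Nn.
  have Nk : (N <= n - k)%N by lia.
  by rewrite -(subnK (leq_trans (leq_addl N k) Nn)); exact: nstepD_gt0 (hN _ Nk) k0.
have /choice[N hN] : forall st : S * S,
    exists N, forall n, (N <= n)%N -> 0 < nstep p n st.1 st.2.
  by move=> [s t]; exact: ev.
by exists (\max_st N st) => s t; apply: (hN (s, t)); exact: leq_bigmax.
Qed.

(* Doeblin: the [m]-step kernel dominates a positive constant [c], and subtracting
   [c] from it does not change its effect on differences of laws. *)
Lemma dist1_contraction (s0 : S) : exists m rho, [/\ 0 <= rho, rho < 1 &
  forall k g mu nu, (m * k <= g)%N -> distr mu -> distr nu ->
    dist1 (iter g (push p) mu) (iter g (push p) nu) <= 2 * rho ^+ k].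
Proof.
have [m q_gt0] := nstep_eventually_gt0.
(* The default 1 is harmless: [c] only has to be positive and below every entry. *)
pose c := \big[Num.min/1]_(st : S * S) nstep p m st.1 st.2.
have c_gt0 : 0 < c by rewrite /c; apply: lt_bigmin => // -[s t] _; exact: q_gt0.
have c_le s t : c <= nstep p m s t.
  by rewrite /c; have := bigmin_le_cond 1 (fun st : S * S => nstep p m st.1 st.2)
     (isT : xpredT (s, t)).
have card_c : \sum_(t : S) c = #|S|%:R * c by rewrite sumr_const mulr_natl.
have step mu nu : distr mu -> distr nu ->
    dist1 (iter m (push p) mu) (iter m (push p) nu) <= (1 - #|S|%:R * c) * dist1 mu nu.
  move=> mu_d nu_d; rewrite /dist1 mulr_sumr.
  have -> : \sum_s (1 - #|S|%:R * c) * `|mu s - nu s| =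
      \sum_t \sum_s `|mu s - nu s| * (nstep p m s t - c).
    rewrite exchange_big /=; apply: eq_bigr => s _.
    by rewrite -mulr_sumr sumrB sum_nstep card_c mulrC.
  apply: ler_sum => t _; rewrite !iter_push_nstep -sumrB.
  have -> : \sum_s (mu s * nstep p m s t - nu s * nstep p m s t) =
      \sum_s (mu s - nu s) * (nstep p m s t - c).
    under [RHS]eq_bigr do rewrite mulrBr.
    rewrite [RHS]sumrB -mulr_suml [\sum_s (mu s - nu s)]sumrB mu_d.2 nu_d.2 subrr mul0r subr0.
    by apply: eq_bigr => s _; rewrite mulrBl.
  apply: le_trans (ler_norm_sum _ _ _) _; apply: ler_sum => s _.
  by rewrite normrM [X in _ * X]ger0_norm// subr_ge0.
have rho_ge0 : 0 <= 1 - #|S|%:R * c.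
  by rewrite subr_ge0 -card_c -(sum_nstep m s0); apply: ler_sum.
exists m, (1 - #|S|%:R * c); split => //.
  rewrite ltrBlDr ltrDl mulr_gt0// ltr0n; apply/card_gt0P; by exists s0.
(* The first [g - m * k] steps merely replace the two laws by others; the last [m * k] contract. The
   factor 2 is the largest distance between two laws. *)
move=> k g mu nu mkg mu_d nu_d; rewrite -(subnKC mkg) !iterD.
have := distr_iter_push p_stoch (g - m * k) mu_d; move: (iter _ _ mu) => {mu_d}mu mu_d.
have := distr_iter_push p_stoch (g - m * k) nu_d; move: (iter _ _ nu) => {nu_d}nu nu_d.
elim: k {mkg} mu nu mu_d nu_d => [|k IH] mu nu mu_d nu_d.
  rewrite muln0 /= expr0 mulr1 /dist1 -[2]/(1 + 1) -{1}mu_d.2 -nu_d.2 -big_split.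
  apply: ler_sum => s _; apply: le_trans (ler_normB _ _) _.
  by rewrite !ger0_norm ?mu_d.1 ?nu_d.1.
rewrite mulnS !iterD.
apply: le_trans (step _ _ (distr_iter_push p_stoch _ mu_d) (distr_iter_push p_stoch _ nu_d)) _.
by rewrite exprS mulrCA ler_wpM2l// IH.
Qed.

End Ergodicity.

(** * Occurrences and starting positions *)

Section Occurrences.
Variable S : finType.
Implicit Types (us ws : seq (seq S)) (v : seq S).

(* [I] lists the positions at which the words of [us] start, counted from 0; the
   first of them must be at least [off]. *)
Fixpoint occurs_at (off : nat) us (I : seq nat) v : bool :=
  match us, I with
  | [::], [::] => true
  | u :: us', i :: I' =>
    [&& (off <= i)%N, take (size u) (drop i v) == u & occurs_at (i + size u) us' I' v]
  | _, _ => false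
  end.

Local Notation concat us ws := (flatten [seq uw.1 ++ uw.2 | uw <- zip us ws]).

Fixpoint starts (i : nat) us ws : seq nat :=
  match us, ws with
  | u :: us', w :: ws' => i :: starts (i + size u + size w) us' ws'
  | _, _ => [::]
  end.

(** The gap after the last word runs to the end of [v], hence the default [size v] of [head]. *)
Fixpoint gaps us (I : seq nat) v : seq (seq S) :=
  match us, I with
  | u :: us', i :: I' =>
    take (head (size v) I' - (i + size u)) (drop (i + size u) v) :: gaps us' I' v
  | _, _ => [::]
  end.

Lemma size_starts i us ws : size us = size ws -> size (starts i us ws) = size us.
Proof. by elim: us ws i => [|u us IH] [|w ws] i //= [uw]; rewrite IH. Qed.

Lemma size_gaps us I v : size us = size I -> size (gaps us I v) = size us.
Proof. by elim: us I => [|u us IH] [|i I] //= [uI]; rewrite IH. Qed.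

Lemma starts_le i us ws j : size us = size ws ->
  j \in starts i us ws -> (j <= i + size (concat us ws))%N.
Proof.
elim: us ws i => [|u us IH] [|w ws] i //= [uw]; rewrite inE !size_cat.
by case/orP => [/eqP->|/(IH _ _ uw)]; lia.
Qed.

Lemma head_starts us ws pre v : size us = size ws -> v = pre ++ concat us ws ->
  head (size v) (starts (size pre) us ws) = size pre.
Proof. by case: us ws => [|u us] [|w ws] //= _ ->; rewrite cats0. Qed.

Lemma occurs_at_starts off us ws pre v :
  size us = size ws -> v = pre ++ concat us ws -> (off <= size pre)%N ->
  occurs_at off us (starts (size pre) us ws) v.
Proof.
elim: us ws off pre => [|u us IH] [|w ws] off pre //= [uw] vE offp.
rewrite offp {1}vE drop_size_cat// -catA take_size_cat// eqxx /=.
rewrite -(size_cat pre) -size_cat; apply: IH => //; first by rewrite vE !catA.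
by rewrite !size_cat -!addnA leq_add2l leq_addr.
Qed.

Lemma gaps_starts us ws pre v :
  size us = size ws -> v = pre ++ concat us ws ->
  gaps us (starts (size pre) us ws) v = ws.
Proof.
elim: us ws pre => [|u us IH] [|w ws] pre //= [uw] vE.
have vE' : v = ((pre ++ u) ++ w) ++ concat us ws by rewrite vE !catA.
rewrite -(size_cat pre) -size_cat IH// (head_starts uw vE') {1}vE'.
by rewrite -[in drop _ _]catA drop_size_cat// [size (_ ++ w)]size_cat addKn take_size_cat.
Qed.

Lemma occurs_at_head_le off us I v : {in I, forall i, (i <= size v)%N} ->
  (off <= size v)%N -> occurs_at off us I v -> (off <= head (size v) I)%N.
Proof. by case: us I => [|u us] [|i I] //= _ _ /andP[]. Qed.

(** If [u] overran the end of [v], [take] would return a shorter word; the bound on [i] is there for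
    an empty [u]. *)
Lemma occurs_at_end u i v : (i <= size v)%N -> take (size u) (drop i v) == u ->
  (i + size u <= size v)%N.
Proof.
move=> iv /eqP/(congr1 size); rewrite size_take_min size_drop => h.
by rewrite -leq_subRL// -h geq_minr.
Qed.

Lemma concat_gaps off us I v : {in I, forall i, (i <= size v)%N} ->
  occurs_at off us I v -> concat us (gaps us I v) = drop (head (size v) I) v.
Proof.
elim: us I off => [|u us IH] [|i I] off //= Iv; first by rewrite drop_size.
case/and3P => offi /[dup] ui /eqP uE occ.
have iv : (i <= size v)%N by apply: Iv; rewrite mem_head.
have Iv' : {in I, forall i, (i <= size v)%N} by move=> j jI; apply: Iv; rewrite inE jI orbT.
have le_h := occurs_at_head_le Iv' (occurs_at_end iv ui) occ.
rewrite (IH _ _ Iv' occ) -catA -{1}uE -[RHS](cat_take_drop (size u)); congr (_ ++ _).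
rewrite drop_drop [(size u + i)%N]addnC.
rewrite -[RHS](cat_take_drop (head (size v) I - (i + size u))) drop_drop; congr (_ ++ drop _ _).
by rewrite subnK.
Qed.

Lemma starts_gaps off us I v : {in I, forall i, (i <= size v)%N} ->
  occurs_at off us I v -> starts (head (size v) I) us (gaps us I v) = I.
Proof.
elim: us I off => [|u us IH] [|i I] off //= Iv.
case/and3P => offi ui occ.
have iv : (i <= size v)%N by apply: Iv; rewrite mem_head.
have Iv' : {in I, forall i, (i <= size v)%N} by move=> j jI; apply: Iv; rewrite inE jI orbT.
have le_h := occurs_at_head_le Iv' (occurs_at_end iv ui) occ.
have h_le : (head (size v) I <= size v)%N.
  by case: (I) Iv' => [|j J] //= /(_ j); apply; rewrite mem_head.
rewrite size_take_min size_drop (minn_idPl _); last by rewrite leq_sub2r.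
by rewrite subnKC// (IH _ _ Iv' occ).
Qed.

Lemma gaps_le us I v w : w \in gaps us I v -> (size w <= size v)%N.
Proof.
elim: us I => [|u us IH] [|i I] //=; rewrite inE => /orP[/eqP->|/IH//].
by rewrite size_take_min size_drop geq_min; apply/orP; right; lia.
Qed.

(** The maps [f] (read off the starts) and [g] (read off the gaps) are inverse bijections between
    factorizations and valid lists of starts. There are [(size v).+1] possible starts because an
    empty word may start at the end of [v]. *)
Lemma occurrencesE d (u : d.-tuple (seq S)) v :
  occurrences u v =
  #|[set I : d.-tuple 'I_(size v).+1 | occurs_at 0 u (map val I) v]%SET|.
Proof.
set n := size v.
pose f (w : n.-bseq S * d.-tuple (n.-bseq S)) : d.-tuple 'I_n.+1 :=
  [tuple inord (nth 0%N (starts (size w.1) u (map val w.2)) j) | j < d].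
pose g (I : d.-tuple 'I_n.+1) : n.-bseq S * d.-tuple (n.-bseq S) :=
  (insub_bseq n (take (head n (map val I)) v),
   [tuple insub_bseq n (nth [::] (gaps u (map val I) v) j) | j < d]).
have sz w : size u = size (map val (w : d.-tuple (n.-bseq S))).
  by rewrite size_map !size_tuple.
have szI I : size u = size (map val (I : d.-tuple 'I_n.+1)).
  by rewrite size_map !size_tuple.
have fE (w : n.-bseq S * d.-tuple (n.-bseq S)) : interleave u w.1 [tuple of map val w.2] = v ->
    map val (f w) = starts (size w.1) u (map val w.2).
  move=> wv; apply: (@eq_from_nth _ 0%N).
    by rewrite size_map size_tuple size_starts ?size_tuple.
  move=> j; rewrite size_map size_tuple => jd.
  rewrite (nth_map ord0) ?size_tuple// -[j]/(val (Ordinal jd)) nth_mktuple /= inordK//.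
  rewrite ltnS; apply: leq_trans (starts_le (sz w.2) (mem_nth _ _)) _.
    by rewrite size_starts ?size_tuple.
  by have := congr1 size wv; rewrite /interleave size_cat => ->.
have gE I : (val (g I).1 = take (head n (map val I)) v) *
   (map val (g I).2 = gaps u (map val I) v).
  split; first by rewrite val_insubd size_take_min geq_minr.
  apply: (@eq_from_nth _ [::]); first by rewrite size_map size_tuple size_gaps ?size_tuple.
  move=> j; rewrite size_map size_tuple => jd.
  rewrite (nth_map (insub_bseq n [::])) ?size_tuple// -[j in LHS]/(val (Ordinal jd)).
  rewrite nth_mktuple val_insubd (@gaps_le u (map val I) v)//.
  by rewrite mem_nth// size_gaps ?size_tuple.
have szI_le I : {in map val (I : d.-tuple 'I_n.+1), forall i, (i <= size v)%N}.
  by move=> _ /mapP[i _ ->]; rewrite -ltnS; exact: ltn_ord.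
have gK (w : n.-bseq S * d.-tuple (n.-bseq S)) : interleave u w.1 [tuple of map val w.2] = v -> g (f w) = w.
  move=> wv; case: w wv => w0 ws wv.
  have vE : v = w0 ++ concat u (map val ws) by rewrite -wv.
  have := gE (f (w0, ws)); rewrite fE//; case: (g _) => g0 gs [g1 g2].
  congr (_, _); apply: val_inj.
    rewrite [LHS]g1 (head_starts (sz ws) vE) [in LHS]vE.
    by rewrite take_size_cat.
  by apply: (inj_map val_inj); rewrite [LHS]g2 gaps_starts.
have -> : [set I : d.-tuple 'I_n.+1 | occurs_at 0 u (map val I) v]%SET =
   (f @: [set w : n.-bseq S * d.-tuple (n.-bseq S) | interleave u w.1 [tuple of map val w.2] == v])%SET.
  apply/setP => I; rewrite inE; apply/idP/imsetP => [occ|[w]].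
    have iv : interleave u (g I).1 [tuple of map val (g I).2] = v.
      rewrite /interleave (gE I).1 /= (gE I).2 (concat_gaps (@szI_le I) occ).
      by rewrite cat_take_drop.
    exists (g I); first by rewrite inE iv.
    apply: val_inj; apply: (inj_map val_inj); rewrite fE// (gE I).2.
    rewrite (gE I).1 size_take_min (minn_idPl _); last first.
      by case: (map _ _) (@szI_le I) => [|j J] //= /(_ j); apply; rewrite mem_head.
    by rewrite (starts_gaps (@szI_le I) occ).
  by rewrite inE => /eqP wv ->; rewrite fE//; exact: occurs_at_starts.
rewrite card_in_imset// => w w'; rewrite !inE => /eqP wv /eqP wv' fw.
by rewrite -(gK w)// fw gK.
Qed.

End Occurrences.

(** * Letters read by an occurrence, and the number of neighbours of a tuple of positions *)

Section Cover.
Variable S : finType.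
Implicit Types (us : seq (seq S)) (v : seq S).

(* The positions of the letters that [occurs_at _ us I] reads. *)
Fixpoint cover us (I : seq nat) : seq nat :=
  match us, I with
  | u :: us', i :: I' => iota i (size u) ++ cover us' I'
  | _, _ => [::]
  end.

Definition total_size us : nat := \sum_(u <- us) size u.

Lemma size_cover us I : (size (cover us I) <= total_size us)%N.
Proof.
rewrite /total_size; elim: us I => [|u us IH] [|i I] //=.
by rewrite big_cons size_cat size_iota leq_add2l.
Qed.

Lemma occurs_at_cover s0 off us I (x y : seq S) : size x = size y ->
  (forall k, k \in cover us I -> nth s0 x k = nth s0 y k) ->
  occurs_at off us I x = occurs_at off us I y.
Proof.
move=> xy; elim: us I off => [|u us IH] [|i I] off //= xyI.
rewrite (IH I (i + size u)%N); last first.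
  by move=> k kI; apply: xyI; rewrite mem_cat kI orbT.
congr [&& _, _ == _ & _]; apply: (@eq_from_nth _ s0).
  by rewrite !size_take_min !size_drop xy.
move=> k; rewrite size_take_min ltn_min => /andP[ku _].
rewrite !nth_take// !nth_drop xyI// mem_cat mem_iota leq_addr/=.
by rewrite ltn_add2l ku.
Qed.

Definition far (ell j k : nat) : bool := (j + ell < k)%N || (k + ell < j)%N.

Definition near_cover (ell : nat) (us : seq (seq S)) (I J : seq nat) : bool :=
  has (fun j => has (fun k => ~~ far ell j k) (cover us J)) (cover us I).

Lemma near_coverN ell us I J j k :
  ~~ near_cover ell us I J -> j \in cover us I -> k \in cover us J -> far ell j k.
Proof. by move=> /hasPn/(_ j) + jI kJ => /(_ jI)/hasPn/(_ k kJ); rewrite negbK. Qed.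

Lemma card_has_le (T : finType) (X : eqType) (Q : T -> X -> bool) (s : seq X) :
  (#|[set t | has (Q t) s]%SET| <= \sum_(x <- s) #|[set t | Q t x]%SET|)%N.
Proof.
elim: s => [|x s IH]; first by rewrite big_nil leqn0 cards_eq0; apply/eqP/setP => t; rewrite !inE.
rewrite big_cons; apply: leq_trans (leq_add (leqnn _) IH).
apply: leq_trans (leq_card_setU _ _).
by apply: subset_leq_card; apply/fintype.subsetP => t; rewrite !inE.
Qed.

Lemma card_tuple_coord d m (l : 'I_d) (A : {set 'I_m}) :
  (#|[set J : d.-tuple 'I_m | tnth J l \in A]%SET| <= #|A| * m ^ d.-1)%N.
Proof.
pose F (l' : 'I_d) : pred 'I_m := fun c => if l' == l then c \in A else true.
have -> : (#|A| * m ^ d.-1 = #|family F|)%N.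
  rewrite card_family; rewrite foldrE big_map big_enum /= (bigD1 l)//= /F eqxx.
  congr (_ * _)%N; rewrite (eq_bigr (fun=> m)) => [|l' /negPf ->]; last first.
    by rewrite -[RHS](card_ord m); apply: eq_card.
  by rewrite prod_nat_const cardC1 card_ord.
pose h (J : d.-tuple 'I_m) : {ffun 'I_d -> 'I_m} := [ffun l' => tnth J l'].
have h_inj : injective h.
  by move=> J J' /ffunP hJ; apply: eq_from_tnth => l'; have := hJ l'; rewrite !ffunE.
rewrite -(card_imset _ h_inj); apply: subset_leq_card; apply/fintype.subsetP => f.
case/imsetP => J; rewrite inE => JA ->; apply/familyP => l'.
by rewrite ffunE /F; case: eqP => [->|].
Qed.

Lemma mem_cover us I k : k \in cover us I -> exists2 l, (l < size us)%N &
  (nth 0%N I l <= k < nth 0%N I l + size (nth [::] us l))%N.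
Proof.
elim: us I => [|u us IH] [|i I] //=; rewrite mem_cat mem_iota.
by case/orP => [ki|/IH[l lu kl]]; [exists 0%N|exists l.+1].
Qed.

(** If the [l]-th word covers [k], its start has at most [size (tnth u l)] values and the other
    [d.-1] starts are free. Summing over [l] gives [total_size u]. *)
Lemma card_cover_mem d m (u : d.-tuple (seq S)) k :
  (#|[set J : d.-tuple 'I_m | k \in cover u (map val J)]%SET|
     <= total_size u * m ^ d.-1)%N.
Proof.
pose hit (l : 'I_d) := [set c : 'I_m | (c <= k < c + size (tnth u l))%N]%SET.
have card_hit l : (#|hit l| <= size (tnth u l))%N.
  set s := size _.
  have f_lt (c : 'I_m) : c \in hit l -> (k - c < s)%N by rewrite inE => ?; lia.
  case: (posnP s) => [s0|s0].
    rewrite s0 leqn0; apply/eqP/eq_card0 => c; apply/negbTE/negP => /f_lt.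
    by rewrite s0.
  (* A start is determined by the offset of [k] in the word, and there are [s] offsets. *)
  pose f (c : 'I_m) : 'I_s := insubd (Ordinal s0) (k - c)%N.
  rewrite -[leqRHS](card_ord s) -(@card_in_imset _ _ f (mem (hit l))).
    exact: max_card.
  move=> c c' /[dup] /f_lt hc + /[dup] /f_lt hc' + /(congr1 val).
  rewrite !inE !val_insubd hc hc' => ? ? ?; apply: val_inj => /=; lia.
have hitP (J : d.-tuple 'I_m) : k \in cover u (map val J) ->
    has (fun l => tnth J l \in hit l) (enum 'I_d).
  move=> /mem_cover[l lu kl]; have ld : (l < d)%N by rewrite -(size_tuple u).
  apply/hasP; exists (Ordinal ld); rewrite ?mem_enum// inE.
  have [i0] : inhabited 'I_m by split; exact: tnth J (Ordinal ld).
  rewrite (nth_map i0) ?size_tuple// in kl.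
  by rewrite (tnth_nth i0) (tnth_nth [::]).
apply: (@leq_trans #|[set J : d.-tuple 'I_m | has (fun l => tnth J l \in hit l) (enum 'I_d)]%SET|).
  by apply: subset_leq_card; apply/fintype.subsetP => J; rewrite !inE; exact: hitP.
apply: leq_trans (card_has_le _ _) _.
rewrite big_enum /= /total_size big_tuple big_distrl /=.
apply: leq_sum => l _; apply: leq_trans (card_tuple_coord _ _) _.
by rewrite leq_mul2r card_hit orbT.
Qed.

(** Each of the at most [total_size u] letters read by [I] has at most [ell.*2.+1] positions within
    distance [ell], and [card_cover_mem] bounds the tuples that cover a given one. *)
Lemma card_near_cover d m ell (u : d.-tuple (seq S)) (I : seq nat) :
  (#|[set J : d.-tuple 'I_m | near_cover ell u I (map val J)]%SET|
     <= ell.*2.+1 * total_size u ^ 2 * m ^ d.-1)%N.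
Proof.
apply: leq_trans (card_has_le _ _) _.
apply: (@leq_trans (\sum_(j <- cover u I) ell.*2.+1 * (total_size u * m ^ d.-1)))%N.
  apply: leq_sum => j _.
  apply: (@leq_trans #|[set J : d.-tuple 'I_m |
      has (fun k => k \in cover u (map val J)) (iota (j - ell) ell.*2.+1)]%SET|).
    apply: subset_leq_card; apply/fintype.subsetP => J; rewrite !inE => /hasP[k kJ].
    rewrite /far => jk; apply/hasP; exists k => //; rewrite mem_iota; lia.
  apply: leq_trans (card_has_le _ _) _.
  apply: leq_trans (leq_sum _ (fun k _ => card_cover_mem m u k)) _.
  by rewrite big_const_seq count_predT size_iota iter_addn_0 mulnC.
rewrite big_const_seq count_predT iter_addn_0.
rewrite [leqRHS](_ : _ = ell.*2.+1 * (total_size u * m ^ d.-1) * total_size u)%N.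
  by rewrite leq_mul2l size_cover orbT.
by rewrite expnS expn1; ring.
Qed.

End Cover.

(** * Trigonometric approximation and convergence in distribution *)

Section BernsteinMean.
Variable R : realType.
Implicit Types (F G : nat -> R) (x c : R).

(* The mean of [F (number of successes)] over [n] independent trials with
   success probability [x], i.e. the Bernstein polynomial with nodes [F k]. *)
Fixpoint bernstein (n : nat) F x : R :=
  if n is m.+1 then x * bernstein m (fun k => F k.+1) x + (1 - x) * bernstein m F x
  else F 0%N.

Lemma bernstein_le n F G x : 0 <= x <= 1 ->
  (forall k, (k <= n)%N -> F k <= G k) -> bernstein n F x <= bernstein n G x.
Proof.
case/andP => x0 x1; elim: n F G => [|n IH] F G FG /=; first exact: FG.
apply: lerD; apply: ler_wpM2l => //; rewrite ?subr_ge0//; apply: IH => k kn.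
  exact: FG.
by apply: FG; exact: leqW.
Qed.

(** The binomial law has mean [n x] and variance [n x (1 - x)]. *)
Lemma bernstein_sqr n (A B c x : R) :
  bernstein n (fun k => A + B * (k%:R - c) ^+ 2) x =
  A + B * ((n%:R * x - c) ^+ 2 + n%:R * x * (1 - x)).
Proof.
elim: n c => [|n IH] c /=; first by rewrite !mul0r addr0.
have -> : (fun k => A + B * (k.+1%:R - c) ^+ 2) = (fun k => A + B * (k%:R - (c - 1)) ^+ 2).
  by apply/funext => k; rewrite -natr1; congr (_ + _ * _ ^+ 2); ring.
by rewrite !IH -natr1; ring.
Qed.

(** Bernstein's argument, with domination by a quadratic in place of Chebyshev's inequality: the
    mean of [(k / n - x)^2] is [x (1 - x) / n <= 1 / n]. *)
Lemma bernstein_approx n F x (a e C : R) : 0 <= x <= 1 -> (0 < n)%N -> 0 <= C ->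
  (forall k, (k <= n)%N -> `|F k - a| <= e + C * (k%:R / n%:R - x) ^+ 2) ->
  `|bernstein n F x - a| <= e + C / n%:R.
Proof.
move=> x01 n0 C0 Fa; have n0' : (n%:R : R) != 0 by rewrite pnatr_eq0 -lt0n.
have quad : e + C / n%:R ^+ 2 * ((n%:R * x - n%:R * x) ^+ 2 + n%:R * x * (1 - x))
    <= e + C / n%:R.
  rewrite lerD2l subrr expr0n add0r.
  have -> : C / n%:R ^+ 2 * (n%:R * x * (1 - x)) = C / n%:R * (x * (1 - x)).
    by field.
  have Cn : 0 <= C / n%:R by rewrite divr_ge0.
  rewrite ler_piMr//; case/andP: x01 => x0 x1.
  by rewrite mulr_ile1// ?subr_ge0// gerBl.
have kE (k : nat) : (k%:R / n%:R - x) ^+ 2 = (k%:R - n%:R * x) ^+ 2 / n%:R ^+ 2.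
  by field.
rewrite ler_norml; apply/andP; split.
  rewrite lerBrDr -[leLHS]opprK opprD opprK.
  have := @bernstein_le n (fun k => (a - e) + (- (C / n%:R ^+ 2)) * (k%:R - n%:R * x) ^+ 2) F x x01.
  rewrite bernstein_sqr => h; apply: le_trans (h _); first by lra.
  move=> k kn; have := Fa k kn; rewrite ler_norml kE => /andP[+ _].
  by rewrite [C * _]mulrA mulrAC; lra.
rewrite lerBlDr.
have := @bernstein_le n F (fun k => (a + e) + (C / n%:R ^+ 2) * (k%:R - n%:R * x) ^+ 2) x x01.
rewrite bernstein_sqr => h; apply: le_trans (h _) _; last by lra.
move=> k kn; have := Fa k kn; rewrite ler_norml kE => /andP[_].
by rewrite [C * _]mulrA mulrAC; lra.
Qed.

Lemma bernstein_bounded n F x c : 0 <= x <= 1 ->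
  (forall k, `|F k| <= c) -> `|bernstein n F x| <= c.
Proof.
move=> /andP[x0 x1] Fc; elim: n F Fc => [|n IH] F Fc //=.
apply: le_trans (ler_normD _ _) _.
have x1' : 0 <= 1 - x by rewrite subr_ge0.
rewrite !normrM (ger0_norm x0) (ger0_norm x1').
have -> : c = x * c + (1 - x) * c by ring.
by apply: lerD; apply: ler_wpM2l => //; apply: IH.
Qed.

End BernsteinMean.

Section TrigonometricApproximation.
Variable R : realType.
Implicit Types (f h : R -> R) (l : seq (R * R * R)).

Definition trig l (y : R) : R := \sum_(a <- l) a.1.1 * cos (a.1.2 * y + a.2).

Definition is_trig h : Prop := exists l, h = trig l.

Lemma is_trigD h1 h2 : is_trig h1 -> is_trig h2 -> is_trig (fun y => h1 y + h2 y).
Proof.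
by move=> [l1 ->] [l2 ->]; exists (l1 ++ l2); apply/funext => y; rewrite /trig big_cat.
Qed.

Lemma is_trigZ c h : is_trig h -> is_trig (fun y => c * h y).
Proof.
move=> [l ->]; exists [seq (c * a.1.1, a.1.2, a.2) | a <- l]; apply/funext => y.
by rewrite /trig big_map mulr_sumr; apply: eq_bigr => a _; rewrite mulrA.
Qed.

Lemma is_trig_cst c : is_trig (fun=> c).
Proof.
exists [:: (c, 0, 0)]; apply/funext => y.
by rewrite /trig big_seq1 /= mul0r addr0 cos0 mulr1.
Qed.

Lemma is_trigM_cos s b h : is_trig h -> is_trig (fun y => cos (s * y + b) * h y).
Proof.
move=> [l ->].
exists ([seq (a.1.1 / 2, s + a.1.2, b + a.2) | a <- l] ++
        [seq (a.1.1 / 2, s - a.1.2, b - a.2) | a <- l]).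
apply/funext => y; rewrite /trig big_cat !big_map /= -big_split mulr_sumr /=.
apply: eq_bigr => a _.
have -> : (s + a.1.2) * y + (b + a.2) = (s * y + b) + (a.1.2 * y + a.2) by ring.
have -> : (s - a.1.2) * y + (b - a.2) = (s * y + b) - (a.1.2 * y + a.2) by ring.
by set A := s * y + b; set B := a.1.2 * y + a.2; rewrite [cos (A + B)]cosD [cos (A - B)]cosB; field.
Qed.

(** At [x = (1 + cos) / 2] the recursion [x A + (1 - x) B] reads [(A + B) / 2 + cos * (A - B) / 2],
    so closure under sums and under products with a cosine suffices. *)
Lemma is_trig_bernstein n (F : nat -> R) s b :
  is_trig (fun y => bernstein n F ((1 + cos (s * y + b)) / 2)).
Proof.
elim: n F => [|n IH] F; first exact: is_trig_cst.
have := is_trigD (is_trigZ (1 / 2) (is_trigD (IH (F \o S)) (IH F)))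
  (is_trigM_cos s b (is_trigZ (1 / 2) (is_trigD (IH (F \o S)) (is_trigZ (-1) (IH F))))).
move=> [l hl]; exists l; rewrite -hl; apply/funext => y /=.
by rewrite /comp; set A := bernstein n _ _; set B := bernstein n _ _; field.
Qed.

Lemma ler_cos : {in `[0, pi : R] &, {mono cos : x y /~ y <= x}}.
Proof. by move=> x y xI yI; rewrite !leNgt ltr_cos. Qed.

(** A quantitative injectivity of the cosine. With midpoint [m] and half-length [h] the sides are
    [2 sin h sin h] and [2 sin m sin h], and [h <= m <= pi - h] gives [sin h <= sin m]. *)
Lemma cosB_ge (a b : R) : 0 <= a -> a <= b -> b <= pi -> 1 - cos (b - a) <= cos a - cos b.
Proof.
move=> a0 ab bpi; have pi0 := pi_ge0 R; pose m := (a + b) / 2; pose h := (b - a) / 2.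
have aE : a = m - h by rewrite /m /h; field.
have bE : b = m + h by rewrite /m /h; field.
have baE : b - a = h + h by rewrite /h; field.
have h0 : 0 <= h by rewrite /h; lra.
have hpi : h <= pi / 2 by rewrite /h; lra.
have sh0 : 0 <= sin h by apply: sin_ge0_pi; lra.
have shm : sin h <= sin m.
  rewrite -!cosBpihalf -[h - _]opprB cosN.
  have mE : cos (m - pi / 2) = cos `|m - pi / 2|.
    by case: (ler0P (m - pi / 2)) => _; rewrite ?cosN.
  rewrite mE ler_cos ?in_itv /=.
  - by rewrite ler_norml /m /h; lra.
  - by rewrite normr_ge0 ler_norml /m; lra.
  - by lra.
rewrite baE cosD {1}bE {1}aE cosB cosD -(cos2Dsin2 h).
have -> : cos h ^+ 2 + sin h ^+ 2 - (cos h * cos h - sin h * sin h) =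
  2 * (sin h * sin h) by ring.
have -> : cos m * cos h + sin m * sin h - (cos m * cos h - sin m * sin h) =
  2 * (sin m * sin h) by ring.
by rewrite ler_wpM2l// ler_wpM2r.
Qed.

Lemma continuous_uniform_itv f (K e : R) : continuous f -> 0 < e ->
  exists2 d, 0 < d & forall y z, `|y| <= K -> `|y - z| < d -> `|f y - f z| <= e.
Proof.
move=> cf e0.
have /compact_near_coveringP/(_ R (0^'+) (fun d y => forall z, `|y - z| < d -> `|f y - f z| <= e)) :=
  @segment_compact R (- K) K.
move=> [].
  move=> x _; have /cvgrPdist_lt/(_ (e / 2)) := cf x; rewrite divr_gt0// => /(_ isT).
  case=> r /= r0 hr; exists (ball x (r / 2), [set d | d < r / 2]) => /=.
    split; first by apply: nbhsx_ballx; rewrite divr_gt0.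
    by apply: nbhs_right_lt; rewrite divr_gt0.
  move=> [y d] /= [xy dr] z yz.
  have h1 : `|f x - f y| < e / 2 by apply: hr => /=; move: xy; rewrite /ball/=; lra.
  have h2 : `|f x - f z| < e / 2.
    apply: hr => /=; move: xy; rewrite /ball/= => xy.
    by have := ler_distD y x z; lra.
  by have := ler_distD (f x) (f y) (f z); rewrite [`|f y - f x|]distrC; lra.
move=> r /= r0 hr; exists (r / 2); first by rewrite divr_gt0.
move=> y z yK; apply: (hr (r / 2)) => //=.
- by rewrite sub0r normrN gtr0_norm; lra.
- by lra.
- by rewrite in_itv /= -ler_norml.
Qed.

(* On [-K, K] the function [f] is a continuous function of
   [x y = (1 + cos (s y + pi / 2)) / 2], to which Bernstein's theorem applies. *)
Lemma trig_approximation f (c K e : R) : continuous f -> (forall y, `|f y| <= c) ->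
  0 < K -> 0 < e ->
  exists h, [/\ is_trig h, forall y, `|h y| <= c &
    forall y, `|y| <= K -> `|f y - h y| <= e].
Proof.
move=> cf fc K0 e0; have pi0 := pi_gt0 R.
have e2 : 0 < e / 2 by rewrite divr_gt0.
have [d d0 hd] := continuous_uniform_itv K cf e2.
(* With this frequency [s y + pi / 2] maps [[-K, K]] onto [[0, pi]], where the cosine is
   injective. *)
pose s := pi / (2 * K); have s0 : 0 < s by rewrite divr_gt0// mulr_gt0.
have sK : s * K = pi / 2 by rewrite /s; field; rewrite gt_eqF.
pose x y := (1 + cos (s * y + pi / 2)) / 2.
have x01 y : 0 <= x y <= 1.
  by have := cos_le1 (s * y + pi / 2); have := cos_geN1 (s * y + pi / 2); rewrite /x; lra.
have ang y : `|y| <= K -> 0 <= s * y + pi / 2 <= pi.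
  rewrite ler_norml => /andP[y1 y2].
  have : s * - K <= s * y by rewrite ler_pM2l.
  have : s * y <= s * K by rewrite ler_pM2l.
  by rewrite mulrN sK; lra.
(* The cap [2 * K] keeps the angle [s * d'] in [[0, pi]]. *)
pose d' := Num.min d (2 * K).
have d'0 : 0 < d' by rewrite lt_min d0 mulr_gt0.
have sd' : 0 < s * d' <= pi.
  rewrite mulr_gt0//=; apply: (@le_trans _ _ (s * (2 * K))).
    by rewrite ler_pM2l// ge_min lexx orbT.
  by rewrite mulrCA sK; lra.
pose eta := (1 - cos (s * d')) / 2.
have eta0 : 0 < eta.
  have : cos (s * d') < cos 0.
    by rewrite ltr_cos ?in_itv /=; lra.
  by rewrite /eta cos0; lra.
have far_x y z : `|y| <= K -> `|z| <= K -> y <= z -> d' <= z - y -> eta <= x y - x z.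
  move=> yK zK yz dyz.
  have /andP[y1 y2] := ang y yK; have /andP[z1 z2] := ang z zK.
  have yz' : s * y + pi / 2 <= s * z + pi / 2 by rewrite lerD2r ler_pM2l.
  have := cosB_ge y1 yz' z2.
  have -> : s * z + pi / 2 - (s * y + pi / 2) = s * (z - y) by ring.
  have szy : s * d' <= s * (z - y) by rewrite ler_pM2l.
  have : cos (s * (z - y)) <= cos (s * d').
    rewrite ler_cos ?in_itv //=; first by lra.
    apply/andP; split; last by lra.
    have -> : s * (z - y) = s * z + pi / 2 - (s * y + pi / 2) by ring.
    by lra.
  by rewrite /eta /x; lra.
have c0 : 0 <= c by exact: le_trans (fc 0).
(* Points at distance at least [d'] have images under [x] at least [eta] apart, so there the
   quadratic term alone reaches [2 * c]. *)
pose C := 2 * c / eta ^+ 2.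
have C0 : 0 <= C by rewrite divr_ge0 ?mulr_ge0// exprn_ge0 ?ltW.
have near_f y z : `|y| <= K -> `|z| <= K ->
    `|f z - f y| <= e / 2 + C * (x z - x y) ^+ 2.
  move=> yK zK; have [yz|yz] := ltP `|z - y| d'.
    apply: (@le_trans _ _ (e / 2)); last by rewrite lerDl mulr_ge0 ?sqr_ge0.
    by apply: hd => //; apply: lt_le_trans yz _; rewrite ge_min lexx.
  have xyz : eta ^+ 2 <= (x z - x y) ^+ 2.
    have : eta <= `|x z - x y|.
      have [zy|zy] := leP z y.
        have := far_x z y zK yK zy; rewrite distrC ger0_norm ?subr_ge0// in yz.
        by move=> /(_ yz) /le_trans; apply; exact: ler_norm.
      have := far_x y z yK zK (ltW zy); rewrite ger0_norm ?subr_ge0 ?(ltW zy)// in yz.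
      by move=> /(_ yz) /le_trans; apply; rewrite distrC ler_norm.
    move=> h; rewrite -[leRHS]ger0_norm ?sqr_ge0// normrX.
    by rewrite lerXn2r ?nnegrE ?(ltW eta0)//.
  apply: (@le_trans _ _ (C * eta ^+ 2)).
    rewrite /C divfK ?gt_eqF ?exprn_gt0//.
    by have := ler_normB (f z) (f y); have := fc z; have := fc y; lra.
  by apply: (@le_trans _ _ (C * (x z - x y) ^+ 2)); [rewrite ler_wpM2l|rewrite lerDr ltW].
have [n n0 Cn] : exists2 n, (0 < n)%N & C / n%:R <= e / 2.
  have := archi_boundP (divr_ge0 C0 (ltW e2)); set n := Num.bound _ => hn.
  have n0 : (0 < n)%N.
    by rewrite -(ltr_nat R); apply: le_lt_trans hn; rewrite divr_ge0// ltW.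
  exists n => //; rewrite ler_pdivrMr ?ltr0n// mulrC -ler_pdivrMr//.
  exact: ltW.
(* The preimage of the node [k / n] under [x]. *)
pose z k := (acos (2 * (k%:R / n%:R) - 1) - pi / 2) / s.
have zP k : (k <= n)%N -> `|z k| <= K /\ x (z k) = k%:R / n%:R.
  move=> kn.
  have r01 : 0 <= (k%:R / n%:R : R) <= 1.
    by rewrite divr_ge0//= ler_pdivrMr ?ltr0n// mul1r ler_nat.
  have r11 : -1 <= 2 * (k%:R / n%:R : R) - 1 <= 1 by lra.
  have szk : s * z k = acos (2 * (k%:R / n%:R) - 1) - pi / 2.
    by rewrite /z mulrC divfK// gt_eqF.
  split.
    have : `|s * z k| <= s * K.
      rewrite sK szk ler_norml; have := acos_ge0 r11; have := acos_lepi r11; lra.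
    by rewrite normrM (gtr0_norm s0) ler_pM2l.
  by rewrite /x szk subrK acosK ?in_itv//; field; rewrite pnatr_eq0 -lt0n.
exists (fun y => bernstein n (fun k => f (z k)) (x y)); split.
- exact: is_trig_bernstein.
(* This bound holds on the whole line, since [x y] never leaves [[0, 1]]; it controls the
   approximation on the tails. *)
- by move=> y; apply: bernstein_bounded.
- move=> y yK; rewrite distrC [e]splitr; apply: le_trans (_ : e / 2 + C / n%:R <= _).
    apply: bernstein_approx => // k kn; have [zk <-] := zP k kn; exact: near_f.
  by rewrite lerD2l.
Qed.

End TrigonometricApproximation.

(** * From convergence of cosines to convergence in distribution *)

Section CharacteristicFunctions.
Variable R : realType.

Lemma integrable_bounded (disp : measure_display) (T : measurableType disp)
    (P : probability T R) (g : T -> R) (c : R) :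
  measurable_fun setT g -> (forall x, `|g x| <= c) ->
  P.-integrable setT (EFin \o g).
Proof.
move=> mg gc; apply: measurable_bounded_integrable => //.
  by rewrite -ge0_fin_numE// fin_num_measure.
exists c; split; first exact: num_real.
by move=> M cM x _; apply: le_trans (gc x) (ltW cM).
Qed.

Lemma Rintegral_bounded_EFin (disp : measure_display) (T : measurableType disp)
    (P : probability T R) (g : T -> R) (c : R) :
  measurable_fun setT g -> (forall x, `|g x| <= c) ->
  (\int[P]_x (g x)%:E)%E = (\int[P]_x g x)%:E.
Proof.
by move=> mg gc; rewrite fineK// integrable_fin_num//; exact: integrable_bounded gc.
Qed.

Lemma measurable_trig l : measurable_fun [set: R] (@trig R l).
Proof.
apply: measurable_sum => a; apply: measurable_funM => //.
apply: measurableT_comp; first exact: continuous_measurable_fun (@continuous_cos R).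
by apply: measurable_funD => //; exact: measurable_funM.
Qed.

Lemma trig_bounded l : exists c, forall y, `|@trig R l y| <= c.
Proof.
exists (\sum_(a <- l) `|a.1.1|) => y; apply: le_trans (ler_norm_sum _ _ _) _.
by apply: ler_sum => a _; rewrite normrM ler_piMr// cos_max.
Qed.

Lemma Rintegral_approx (disp : measure_display) (T : measurableType disp)
    (P : probability T R) (Y : T -> R) (f h : R -> R) (c K e : R) :
  measurable_fun setT Y -> measurable_fun setT f -> measurable_fun setT h ->
  (forall y, `|f y| <= c) -> (forall y, `|h y| <= c) -> 0 <= e ->
  (forall y, `|y| <= K -> `|f y - h y| <= e) ->
  `|\int[P]_x f (Y x) - \int[P]_x h (Y x)|
    <= e + 2 * c * fine (P [set x | K < `|Y x|]).
Proof.
move=> mY mf mh fc hc e0 fh.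
have mfY : measurable_fun setT (f \o Y) by exact: measurableT_comp.
have mhY : measurable_fun setT (h \o Y) by exact: measurableT_comp.
have if_ : P.-integrable setT (EFin \o (f \o Y)).
  by apply: (@integrable_bounded _ _ P _ (c)) => // x; exact: fc.
have ih_ : P.-integrable setT (EFin \o (h \o Y)).
  by apply: (@integrable_bounded _ _ P _ (c)) => // x; exact: hc.
pose A := [set x | K < `|Y x|].
have mA : measurable A.
  rewrite /A -[X in measurable X]setTI; apply: measurable_fun_ltr => //.
  exact: measurableT_comp.
have c0 : 0 <= c by exact: le_trans (fc 0).
have fhA x : `|f (Y x) - h (Y x)| <= e + 2 * c * \1_A x.
  rewrite indicE; case: (boolP (x \in A)) => [_|].
    have := ler_normB (f (Y x)) (h (Y x)); have := fc (Y x); have := hc (Y x).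
    by rewrite mulr1; lra.
  rewrite notin_setE /A /= => /negP; rewrite -leNgt => YK.
  by rewrite mulr0 addr0; exact: fh.
have iA : P.-integrable setT (EFin \o (fun x => e + 2 * c * \1_A x)).
  apply: (@integrable_bounded _ _ P _ (e + 2 * c)).
    by apply: measurable_funD => //; apply: measurable_funM => //; exact: measurable_indic.
  by move=> x; rewrite ger0_norm ?addr_ge0 ?mulr_ge0// lerD2l ler_piMr ?mulr_ge0//.
have ifh : P.-integrable setT (EFin \o (fun x => f (Y x) - h (Y x))).
  apply: (@integrable_bounded _ _ P _ (c + c)); first exact: measurable_funB.
  by move=> x; apply: le_trans (ler_normB _ _) (lerD _ _).
rewrite -RintegralB//.
apply: le_trans (le_normr_Rintegral measurableT ifh) _.
have -> : e + 2 * c * fine (P A) = \int[P]_x (e + 2 * c * \1_A x).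
  rewrite RintegralD//; last 2 first.
  - exact: (@integrable_bounded _ _ P _ (`|e|)).
  - apply: (@integrable_bounded _ _ P _ (2 * c)).
      by apply: measurable_funM => //; exact: measurable_indic.
    by move=> x; rewrite ger0_norm ?mulr_ge0// ler_piMr ?mulr_ge0//.
  rewrite RintegralZl//; last exact: integrable_indic.
  rewrite Rintegral_cst// [X in e * fine X](@probability_setT _ _ _ P) mulr1.
  by rewrite /Rintegral integral_indic// setIT.
apply: le_Rintegral => //.
exact: (integrable_abse ifh).
Qed.

(** Chebyshev's inequality. *)
Lemma prob_tail_sqr (disp : measure_display) (T : measurableType disp)
    (P : probability T R) (Y : T -> R) (C K : R) :
  measurable_fun setT Y -> (\int[P]_x (Y x ^+ 2)%:E <= C%:E)%E -> 0 < K ->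
  fine (P [set x | K < `|Y x|]) <= C / K ^+ 2.
Proof.
move=> mY YC K0; set A := [set x | _].
have mA : measurable A.
  rewrite /A -[X in measurable X]setTI; apply: measurable_fun_ltr => //.
  exact: measurableT_comp.
have K20 : 0 < K ^+ 2 by rewrite exprn_gt0.
rewrite -lee_fin fineK ?fin_num_measure//.
have -> : P A = (\int[P]_x (\1_A x)%:E)%E by rewrite integral_indic// setIT.
apply: (@le_trans _ _ (\int[P]_x ((K ^+ 2)^-1 * Y x ^+ 2)%:E)%E).
  apply: ge0_le_integral => //.
  - by apply/measurable_EFinP; exact: measurable_indic.
  - apply/measurable_EFinP; apply: measurable_funM => //; exact: measurable_funX.
  - move=> x _; rewrite lee_fin indicE; case: (boolP (x \in A)) => [|_].
      rewrite inE /A/= => KY; rewrite mulrC ler_pdivlMr// mul1r.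
      by rewrite -[leRHS]ger0_norm ?sqr_ge0// normrX lerXn2r ?nnegrE ?(ltW K0) ?(ltW KY).
    by rewrite mulr_ge0 ?sqr_ge0// invr_ge0 ltW.
under eq_integral do rewrite EFinM.
rewrite ge0_integralZl//; last 3 first.
- by apply/measurable_EFinP; exact: measurable_funX.
- by move=> x _; rewrite lee_fin sqr_ge0.
- by rewrite lee_fin invr_ge0 ltW.
by rewrite mulrC EFinM lee_wpmul2l// lee_fin invr_ge0 ltW.
Qed.

Lemma prob_tight (mu : probability (measurableTypeR R) R) (e : R) : 0 < e ->
  exists2 K, 0 < K & fine (mu [set x | K < `|x|]) <= e.
Proof.
move=> e0; pose F (n : nat) : set R := [set x | n%:R < `|x|].
have mF n : measurable (F n : set (measurableTypeR R)).
  by rewrite /F -[X in measurable X]setTI; apply: measurable_fun_ltr.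
have F0 : \bigcap_n F n = set0.
  apply/seteqP; split => // x Fx.
  have := archi_boundP (normr_ge0 x); rewrite ltNge => /negP; apply.
  exact: ltW (Fx _ I).
have F_cvg : mu \o F @ \oo --> 0%:E.
  have <- : mu (\bigcap_n F n) = 0%:E by rewrite F0 measure0.
  apply: nonincreasing_cvg_mu => //.
  - by apply: le_lt_trans (probability_le1 mu (mF 0%N)) _; rewrite ltry.
  - by rewrite F0; exact: measurable0.
  - by move=> m n mn; apply/subsetPset => x; apply: le_lt_trans; rewrite ler_nat.
have /fine_cvgP[_ /cvgrPdist_le/(_ e e0)[N _ hN]] := F_cvg.
exists N.+1%:R; first exact: ltr0Sn.
by have := hN N.+1 (leqnSn N); rewrite /= sub0r normrN; apply: le_trans; exact: ler_norm.
Qed.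

Theorem cos_cvg_in_distribution (disp : measure_display) (T : measurableType disp)
    (P : probability T R) (Y : nat -> T -> R)
    (mu : probability (measurableTypeR R) R) (C : R) :
  (forall N, measurable_fun setT (Y N)) ->
  (\forall N \near \oo, (\int[P]_x (Y N x ^+ 2)%:E <= C%:E)%E) ->
  (forall t b, \int[P]_x cos (t * Y N x + b) @[N --> \oo] -->
     \int[mu]_x cos (t * x + b)) ->
  cvg_in_distribution P Y mu.
Proof.
move=> mY YC hcos f cf [M0 [_ fM]].
have {M0 fM}[c fc] : exists c, forall y, `|f y| <= c.
  by exists (M0 + 1) => y; apply: fM => //; rewrite ltrDl.
have c0 : 0 <= c by exact: le_trans (fc 0).
have mf : measurable_fun setT f by exact: continuous_measurable_fun.
have mcos t b : measurable_fun setT (fun x : R => cos (t * x + b)).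
  apply: measurableT_comp; first exact: continuous_measurable_fun (@continuous_cos R).
  by apply: measurable_funD => //; exact: measurable_funM.
have trig_cvg l : \int[P]_x trig l (Y N x) @[N --> \oo] --> \int[mu]_x trig l x.
  have int_trig d' (T' : measurableType d') (Q : probability T' R) (X : T' -> R) l' :
      measurable_fun setT X -> Q.-integrable setT (EFin \o (fun x => trig l' (X x))).
    move=> mX; have [c' hc'] := trig_bounded l'.
    apply: (@integrable_bounded _ _ Q _ c') => //.
    by apply: measurableT_comp => //; exact: measurable_trig.
  have int_cos d' (T' : measurableType d') (Q : probability T' R) (X : T' -> R) t b :
      measurable_fun setT X -> Q.-integrable setT (EFin \o (fun x => cos (t * X x + b))).
    move=> mX; apply: (@integrable_bounded _ _ Q _ 1) => [|x]; last exact: cos_max.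
    exact: measurableT_comp (mcos t b) mX.
  have trig_cons d' (T' : measurableType d') (Q : probability T' R) (X : T' -> R) a l' :
      measurable_fun setT X -> \int[Q]_x trig (a :: l') (X x) =
      a.1.1 * \int[Q]_x cos (a.1.2 * X x + a.2) + \int[Q]_x trig l' (X x).
    move=> mX; rewrite -RintegralZl ?int_cos// -RintegralD ?int_trig//; last first.
      by apply: (@integrableZl _ _ _ Q _ _ a.1.1 (EFin \o _)) => //; exact: int_cos.
    by congr Rintegral; apply/funext => x; rewrite /trig big_cons.
  have trig_nil d' (T' : measurableType d') (Q : probability T' R) (X : T' -> R) :
      \int[Q]_x trig [::] (X x) = 0.
    rewrite (_ : (fun x => _) = cst 0) ?Rintegral_cst ?mul0r//.
    by apply/funext => x; rewrite /trig big_nil.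
  elim: l => [|a l IH].
    by rewrite (trig_nil _ _ mu id); under eq_fun do rewrite trig_nil; exact: cvg_cst.
  rewrite (trig_cons _ _ mu id a l)//; under eq_fun do rewrite trig_cons//.
  by apply: cvgD => //; apply: cvgMr; exact: hcos.
suff fcvg : \int[P]_x f (Y N x) @[N --> \oo] --> \int[mu]_x f x.
  have -> : (fun N => 'E_P[f \o Y N]%E) = (fun N => (\int[P]_x f (Y N x))%:E).
    apply/funext => N; rewrite unlock (@Rintegral_bounded_EFin _ _ P _ c)//.
      exact: measurableT_comp.
    by move=> x; exact: fc.
  rewrite (@Rintegral_bounded_EFin _ _ mu f c mf fc).
  by apply: cvg_EFin => //; exact: nearW.
apply/cvgrPdist_le => e e0.
(* Replacing [f] by [h] will cost [e / 4] under each of the two laws, and the convergence for [h]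
   another [e / 8]. *)
have e8 : 0 < e / 8 by rewrite divr_gt0.
have c1 : 0 < 2 * c + 1 by rewrite ltr_wpDl// mulr_ge0.
have [K0 K00 muK0] := @prob_tight mu (e / 8 / (2 * c + 1)) (divr_gt0 e8 c1).
(* Chosen so that [|C| / K1] is at most [e / 8 / (2 * c + 1)]. The leading 1 gives [K <= K ^+ 2],
   and [2 * c + 1] replaces [2 * c] lest [c] vanish. *)
pose K1 := 1 + (2 * c + 1) * `|C| / (e / 8).
have K11 : 1 <= K1.
  by rewrite /K1 lerDl; apply: divr_ge0; [apply: mulr_ge0 => //; exact: ltW|exact: ltW].
pose K := Num.max K0 K1.
have KK1 : K1 <= K by rewrite le_max lexx orbT.
have K_gt0 : 0 < K by lra.
have tail_small (t : R) : t <= e / 8 / (2 * c + 1) -> 2 * c * t <= e / 8.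
  rewrite ler_pdivlMr// => tc; have [t0|t0] := lerP 0 t; first lra.
  by apply: (@le_trans _ _ 0); [rewrite mulr_ge0_le0 ?mulr_ge0// ltW|lra].
have [h [h_trig hc fh]] := trig_approximation cf fc K_gt0 e8.
have mh : measurable_fun setT h by case: h_trig => l ->; exact: measurable_trig.
have mu_part : `|\int[mu]_x f x - \int[mu]_x h x| <= e / 8 + e / 8.
  apply: le_trans (@Rintegral_approx _ _ mu id f h c K (e / 8) _ _ _ _ _ _ _) _ => //.
    exact: ltW.
  rewrite lerD2l; apply: tail_small; apply: le_trans muK0.
  apply: fine_le; rewrite ?fin_num_measure//; try by
    rewrite -[X in measurable X]setTI; apply: measurable_fun_ltr => //; exact: normr_measurable.
  apply: le_measure; rewrite ?inE; try by
    rewrite -[X in measurable X]setTI; apply: measurable_fun_ltr => //; exact: normr_measurable.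
  by move=> x /=; apply: le_lt_trans; rewrite le_max lexx.
have hcvg : \int[P]_x h (Y N x) @[N --> \oo] --> \int[mu]_x h x.
  by case: h_trig => l ->; exact: trig_cvg.
move/cvgrPdist_le: hcvg => /(_ _ e8) hcvg.
near=> N.
have YCN : (\int[P]_x (Y N x ^+ 2)%:E <= C%:E)%E by near: N.
have : `|\int[mu]_x h x - \int[P]_x h (Y N x)| <= e / 8 by near: N.
have : `|\int[P]_x f (Y N x) - \int[P]_x h (Y N x)| <= e / 8 + e / 8.
  apply: le_trans (@Rintegral_approx _ _ P (Y N) f h c K (e / 8) _ _ _ _ _ _ _) _ => //.
    exact: ltW.
  rewrite lerD2l; apply: tail_small.
  apply: le_trans (prob_tail_sqr (mY N) YCN K_gt0) _.
  have KK : K1 <= K ^+ 2.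
    by apply: (le_trans KK1); rewrite expr2 ler_peMr ?(ltW K_gt0)// (le_trans K11 KK1).
  apply: (@le_trans _ _ (`|C| / K1)).
    apply: (@le_trans _ _ (`|C| / K ^+ 2)).
      by rewrite ler_pM2r ?ler_norm// invr_gt0 exprn_gt0.
    by rewrite ler_wpM2l// lef_pV2 ?posrE ?exprn_gt0// (lt_le_trans ltr01 K11).
  rewrite ler_pdivrMr; last exact: lt_le_trans ltr01 K11.
  rewrite mulrAC ler_pdivlMr// /K1.
  have -> : e / 8 * (1 + (2 * c + 1) * `|C| / (e / 8)) = e / 8 + (2 * c + 1) * `|C|.
    by field; rewrite gt_eqF.
  by rewrite mulrC lerDr ltW.
move: mu_part; rewrite !ler_norml; lra.
Unshelve. all: by end_near.
Qed.

End CharacteristicFunctions.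

(** * The Gaussian characteristic function *)

Section GaussianCharacteristicFunction.
Variable R : realType.
Local Notation leb := (@lebesgue_measure R).

(* The characteristic function of a centered Gaussian law of variance [v]
   solves [c' = - v t c]; an approximate solution is compared with it by
   applying the mean value theorem to [c t * exp (v t^2 / 2)]. *)
Lemma gaussian_ode (c c' : R -> R) (v e t : R) : 0 <= v -> 0 <= t ->
  (forall s : R, is_derive s 1 c (c' s)) ->
  (forall s, 0 <= s <= t -> `|c' s + v * s * c s| <= e) ->
  `|c t - c 0 * expR (- (v * t ^+ 2 / 2))| <= t * e.
Proof.
move=> v0 t0 dc hc; pose h s := c s * expR (v * s ^+ 2 / 2).
have dh (s : R) : is_derive s 1 h ((c' s + v * s * c s) * expR (v * s ^+ 2 / 2)).
  rewrite /h; apply: is_derive_eq.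
  by rewrite /GRing.scale /= !mulr1; field.
have ch : {within `[0, t], continuous h}.
  by apply: derivable_within_continuous => s _; exact: ex_derive.
have [s] := MVT_segment t0 (fun s _ => dh s) ch.
rewrite in_itv /= => st; rewrite /h expr0n /= mulr0 mul0r expR0 mulr1 subr0 => hE.
have -> : c t - c 0 * expR (- (v * t ^+ 2 / 2)) =
   (c t * expR (v * t ^+ 2 / 2) - c 0) * expR (- (v * t ^+ 2 / 2)).
  by rewrite [RHS]mulrBl -[X in _ = X - _]mulrA -expRD addrN expR0 mulr1.
rewrite hE !normrM (ger0_norm t0) !(ger0_norm (expR_ge0 _)).
have st1 : expR (v * s ^+ 2 / 2) * expR (- (v * t ^+ 2 / 2)) <= 1.
  rewrite -expRD -[leRHS]expR0 ler_expR subr_le0 ler_pM2r ?invr_gt0// ler_wpM2l//.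
  by case/andP: st => s0 s_t; rewrite lerXn2r ?nnegrE.
have -> : `|c' s + v * s * c s| * expR (v * s ^+ 2 / 2) * t * expR (- (v * t ^+ 2 / 2)) =
    t * (`|c' s + v * s * c s| * (expR (v * s ^+ 2 / 2) * expR (- (v * t ^+ 2 / 2)))).
  by ring.
rewrite ler_wpM2l// -[leRHS]mulr1 ler_pM ?mulr_ge0 ?expR_ge0//.
exact: hc.
Qed.

Variable s : R.
Hypothesis s_neq0 : s != 0.
Local Notation phi := (normal_pdf 0 s).

(** The factor [x^2] is absorbed by a Gaussian of twice the standard deviation: with
    [q = x^2 / (8 s^2)] the exponents are [-4 q] and [-q], and [3 q exp(-3 q) <= 1]. *)
Lemma integrable_normal_pdf_sqr :
  leb.-integrable setT (fun x => (x ^+ 2 * phi x)%:E).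
Proof.
have s2 : 0 < s ^+ 2 by rewrite exprn_even_gt0.
have s2_neq0 : 2 * s != 0 by rewrite mulf_neq0// pnatr_eq0.
pose k := normal_peak s * (8 * s ^+ 2 / 3) / normal_peak (2 * s).
have k_int : leb.-integrable setT (fun x => (k * normal_pdf 0 (2 * s) x)%:E).
  under eq_fun do rewrite EFinM.
  by apply: integrableZl => //; exact: integrable_normal_pdf.
apply: le_integrable k_int => //.
  apply/measurable_EFinP; apply: measurable_funM; first exact: measurable_funX.
  exact: measurable_normal_pdf.
move=> x _; have xphi : 0 <= x ^+ 2 * phi x.
  by apply: mulr_ge0; [exact: sqr_ge0|exact: normal_pdf_ge0].
rewrite lee_fin (ger0_norm xphi).
apply: le_trans (ler_norm _); rewrite !normal_pdfE// /k.
have peak2 : normal_peak (2 * s) != 0 by rewrite gt_eqF// normal_peak_gt0.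
have -> : normal_peak s * (8 * s ^+ 2 / 3) / normal_peak (2 * s) *
    (normal_peak (2 * s) * normal_fun 0 (2 * s) x) =
    normal_peak s * (8 * s ^+ 2 / 3 * normal_fun 0 (2 * s) x) by field.
rewrite mulrCA ler_wpM2l ?normal_peak_ge0//.
rewrite /normal_fun subr0.
pose q := x ^+ 2 / (8 * s ^+ 2).
have -> : - x ^+ 2 / (s ^+ 2 *+ 2) = - (3 * q) + - q by rewrite /q; field.
have -> : - x ^+ 2 / ((2 * s) ^+ 2 *+ 2) = - q by rewrite /q; field.
have -> : x ^+ 2 = (8 * s ^+ 2 / 3) * (3 * q) by rewrite /q; field.
have le1 : 3 * q * expR (- (3 * q)) <= 1.
  rewrite expRN ler_pdivrMr ?expR_gt0// mul1r.
  by apply: le_trans (expR_ge1Dx _); rewrite lerDr.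
rewrite expRD.
have -> : 8 * s ^+ 2 / 3 * (3 * q) * (expR (- (3 * q)) * expR (- q)) =
  8 * s ^+ 2 / 3 * expR (- q) * (3 * q * expR (- (3 * q))) by ring.
by rewrite ler_piMr// mulr_ge0 ?expR_ge0// divr_ge0// mulr_ge0// ltW.
Qed.

Lemma integrable_quadratic_normal (g : R -> R) (c : R) : measurable_fun setT g ->
  (forall x, `|g x| <= c * (1 + x ^+ 2)) ->
  leb.-integrable setT (fun x => (g x * phi x)%:E).
Proof.
move=> mg gc.
have int1 : leb.-integrable setT (fun x => ((c * (1 + x ^+ 2)) * phi x)%:E).
  have -> : (fun x => ((c * (1 + x ^+ 2)) * phi x)%:E) =
     (fun x => c%:E * ((phi x)%:E + (x ^+ 2 * phi x)%:E))%E.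
    by apply/funext => x; rewrite -EFinD -EFinM; congr EFin; ring.
  apply: integrableZl => //; apply: integrableD => //.
    exact: integrable_normal_pdf.
  exact: integrable_normal_pdf_sqr.
apply: le_integrable int1 => //.
  apply/measurable_EFinP; apply: measurable_funM => //; exact: measurable_normal_pdf.
move=> x _; rewrite lee_fin !normrM; apply: ler_wpM2r => //.
by rewrite -normrM; apply: le_trans (ler_norm _).
Qed.

(** From [exp(-y) <= 1 / y] the density is at most a constant over [x^2]. This removes the boundary
    terms in the integration by parts. *)
Lemma normal_pdf_cvg_at_infty (e : R) : 0 < e ->
  exists N, forall n, (N <= n)%N -> phi n.+1%:R <= e /\ phi (- n.+1%:R) <= e.
Proof.
move=> e0; have s2 : 0 < s ^+ 2 by rewrite exprn_even_gt0.
pose k := normal_peak s * (2 * s ^+ 2).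
have k0 : 0 <= k by rewrite mulr_ge0 ?normal_peak_ge0// mulr_ge0// ltW.
have bnd x : x != 0 -> phi x <= k / x ^+ 2.
  move=> x0; have x2 : 0 < x ^+ 2 by rewrite exprn_even_gt0.
  rewrite normal_pdfE// /k -mulrA ler_wpM2l ?normal_peak_ge0//.
  rewrite /normal_fun subr0 mulNr expRN -[leRHS]invf_div lef_pV2 ?posrE ?expR_gt0 ?divr_gt0//.
    by apply: le_trans (expR_ge1Dx _); rewrite -[s ^+ 2 *+ 2]mulr_natl lerDr.
  by rewrite mulr_gt0.
exists (Num.bound (k / e)) => n Nn.
have kn : k / n.+1%:R ^+ 2 <= e.
  have n1 : (1 : R) <= n.+1%:R by rewrite ler1n.
  have n2 : 0 < n.+1%:R ^+ 2 :> R by rewrite exprn_gt0.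
  rewrite ler_pdivrMr// mulrC -ler_pdivrMr//.
  apply: le_trans (ltW (archi_boundP (divr_ge0 k0 (ltW e0)))) _.
  apply: (@le_trans _ _ n.+1%:R); first by rewrite ler_nat leqW.
  by rewrite expr2 ler_peMr.
have nn0 : (n.+1%:R : R) != 0 by rewrite pnatr_eq0.
split; first exact: le_trans (bnd _ nn0) kn.
by apply: le_trans (bnd _ _) _; rewrite ?oppr_eq0// sqrrN.
Qed.

Lemma is_derive_normal_pdf (x : R) : is_derive x 1 phi (- (x / s ^+ 2) * phi x).
Proof.
rewrite normal_pdfE// /normal_fun; apply: is_derive_eq.
by rewrite /GRing.scale /= !subr0 -mulr_natr; field.
Qed.

(** Stein's identity for the Gaussian law. The derivative of [g phi] is [g' phi - x g phi / s^2],
    and its integral over the line is the limit of boundary terms, which is 0. *)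
Lemma normal_pdf_bounded_parts (g g' : R -> R) (c : R) :
  (forall x : R, is_derive x 1 g (g' x)) -> continuous g' ->
  (forall x, `|g x| <= c) -> (forall x, `|g' x| <= c) ->
  \int[leb]_x (x * g x * phi x) = s ^+ 2 * \int[leb]_x (g' x * phi x).
Proof.
move=> dg cg' gc g'c.
have s2 : 0 < s ^+ 2 by rewrite exprn_even_gt0.
have c0 : 0 <= c by exact: le_trans (gc 0).
have cg : continuous g.
  by move=> x; apply: differentiable_continuous; apply/derivable1_diffP; exact: ex_derive.
have mg : measurable_fun setT g by exact: continuous_measurable_fun.
have mg' : measurable_fun setT g' by exact: continuous_measurable_fun.
have int_g' : leb.-integrable setT (fun x => (g' x * phi x)%:E).
  apply: (@integrable_quadratic_normal g' c) => // x.
  by apply: le_trans (g'c x) _; rewrite ler_peMr// lerDl sqr_ge0.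
have int_xg : leb.-integrable setT (fun x => (x * g x * phi x)%:E).
  apply: (@integrable_quadratic_normal (fun x => x * g x) c).
    exact: measurable_funM.
  move=> x; rewrite normrM mulrC; apply: ler_pM => //.
  have [x1|x1] := lerP `|x| 1.
    by apply: le_trans x1 _; rewrite lerDl sqr_ge0.
  apply: (@le_trans _ _ (x ^+ 2)); last by rewrite lerDr.
  by rewrite -[leRHS]ger0_norm ?sqr_ge0// normrX expr2 ler_peMr// ltW.
pose F x := g x * phi x.
pose D x := g' x * phi x + (- (s ^+ 2)^-1) * (x * g x * phi x).
have dF (x : R) : is_derive x 1 F (D x).
  have := is_derive_normal_pdf x => dphi.
  by rewrite /F; apply: is_derive_eq; rewrite /GRing.scale /D /=; field.
have cphi : continuous phi by exact: continuous_normal_pdf.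
have cD : continuous D.
  move=> x; apply: cvgD.
    by apply: cvgM; [exact: cg'|exact: cphi].
  apply: cvgM; first exact: cvg_cst.
  apply: cvgM; last exact: cphi.
  by apply: cvgM; [exact: cvg_id|exact: cg].
have int_D : leb.-integrable setT (fun x => (D x)%:E).
  have -> : (fun x => (D x)%:E) = (fun x => (g' x * phi x)%:E +
     (- (s ^+ 2)^-1)%:E * (x * g x * phi x)%:E)%E by apply/funext => x.
  by apply: integrableD => //; exact: integrableZl.
have FTC n : (\int[leb]_(x in `[(- n.+1%:R)%R, n.+1%:R]) (D x)%:E =
    (F n.+1%:R)%:E - (F (- n.+1%:R))%:E)%E.
  apply: continuous_FTC2.
  - by apply: (@lt_trans _ _ 0%R); rewrite ?oppr_lt0 ltr0n.
  - exact: continuous_subspaceT.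
  - split => [x _||]; first exact: ex_derive.
    + apply: cvg_at_right_filter; apply: differentiable_continuous.
      by apply/derivable1_diffP; exact: ex_derive.
    + apply: cvg_at_left_filter; apply: differentiable_continuous.
      by apply/derivable1_diffP; exact: ex_derive.
  - by move=> x _; rewrite derive1E; exact: derive_val.
have F_cvg : (F n.+1%:R - F (- n.+1%:R)) @[n --> \oo] --> 0.
  apply/cvgrPdist_le => e e0.
  have c1 : 0 < 2 * (c + 1) by rewrite mulr_gt0// ltr_wpDl.
  have [N hN] := normal_pdf_cvg_at_infty (divr_gt0 e0 c1).
  exists N => // n /= Nn; have [h1 h2] := hN n Nn.
  have Fle x : phi x <= e / (2 * (c + 1)) -> `|F x| <= e / 2.
    move=> px; rewrite normrM (ger0_norm (normal_pdf_ge0 _ _ _)).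
    apply: (@le_trans _ _ ((c + 1) * (e / (2 * (c + 1))))).
      apply: ler_pM => //; first exact: normal_pdf_ge0.
      by apply: le_trans (gc x) _; rewrite lerDl.
    suff -> : (c + 1) * (e / (2 * (c + 1))) = e / 2 by [].
    by field; rewrite gt_eqF// ltr_wpDl.
  rewrite sub0r normrN; apply: le_trans (ler_normB _ _) _.
  by rewrite [e]splitr lerD// Fle.
have int_cvg : (\int[leb]_(x in `[(- n.+1%:R)%R, n.+1%:R]) (D x)%:E)%E @[n --> \oo]
    --> (\int[leb]_x (D x)%:E)%E.
  pose f_ n := (fun x => (D x)%:E) \_ `[(- n.+1%:R)%R, n.+1%:R]%classic.
  have -> : (fun n => \int[leb]_(x in `[(- n.+1%:R)%R, n.+1%:R]) (D x)%:E)%E =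
      (fun n => \int[leb]_x f_ n x)%E.
    by apply/funext => n; rewrite integral_mkcond.
  have mD : measurable_fun setT (fun x => (D x)%:E) by exact: measurable_int int_D.
  have itv_bnd n x : f_ n x = if `|x| <= n.+1%:R then (D x)%:E else 0%E.
    by rewrite /f_ patchE ler_norml mem_setE in_itv.
  have [] := @dominated_convergence _ _ _ leb setT measurableT f_ (fun x => (D x)%:E)
    (fun x => `|(D x)%:E|)%E _ mD _ (integrable_abse int_D) _ => //.
  - by move=> n; apply/(measurable_restrictT _ _).1 => //; exact: measurable_funTS.
  - apply: aeW => x _; apply: cvg_near_cst.
    exists (Num.bound `|x|) => // n /= xn; rewrite itv_bnd ifT//.
    apply: le_trans (ltW (archi_boundP (normr_ge0 x))) _.
    by rewrite ler_nat leqW.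
  - apply: aeW => x n _; rewrite itv_bnd; case: ifP => // _.
    by rewrite abse0 abse_ge0.
have D0 : (\int[leb]_x (D x)%:E)%E = 0%:E.
  apply: (cvg_unique (@ereal_hausdorff R) int_cvg).
  have /funext -> : forall n, (\int[leb]_(x in `[(- n.+1%:R)%R, n.+1%:R]) (D x)%:E)%E =
      (F n.+1%:R - F (- n.+1%:R))%:E by move=> n; rewrite FTC EFinB.
  by apply: cvg_EFin F_cvg; exact: nearW.
have : \int[leb]_x D x = 0 by rewrite /Rintegral D0.
rewrite RintegralD//; last first.
  exact: (@integrableZl _ _ _ leb _ _ (- (s ^+ 2)^-1) (EFin \o _)).
rewrite RintegralZl// => /eqP; rewrite mulNr subr_eq0 => /eqP ->.
by rewrite mulrA divff ?mul1r// gt_eqF.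
Qed.

(** The change of variables involves the Radon-Nikodym derivative, which agrees with the density
    only almost everywhere. *)
Lemma integral_normal_prob (g : R -> R) (c : R) :
  measurable_fun setT g -> (forall x, `|g x| <= c) ->
  \int[normal_prob 0 s]_x g x = \int[leb]_x (g x * phi x).
Proof.
move=> mg gc; have dom := @normal_prob_dominates R 0 s.
have ig : (normal_prob 0 s).-integrable setT (EFin \o g) 
    by exact: (@integrable_bounded R _ _ (normal_prob 0 s : probability _ R) g c).
rewrite /Rintegral -(Radon_Nikodym_change_of_variables dom)//=; congr fine.
set RN := Radon_Nikodym _ _.
have mgE : measurable_fun setT (EFin \o g) by exact/measurable_EFinP.
apply: ae_eq_integral => //.
- by apply: emeasurable_funM => //; apply: (measurable_int leb);
    exact: Radon_Nikodym_integrable.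
- apply/measurable_EFinP; apply: measurable_funM => //; exact: measurable_normal_pdf.
- have : ae_eq leb setT RN (EFin \o phi).
    rewrite /RN Radon_NikodymE.
    case: cid => h [h1 h2 h3]; apply: integral_ae_eq => //.
    + by apply/measurable_EFinP; exact: measurable_normal_pdf.
    + by move=> E _ mE; rewrite -h3.
  by apply: filterS => x /= /[apply] ->; rewrite EFinM.
Qed.

(** Stein's identity applied to [sin (u x + b)] is the equation of [gaussian_ode] with error 0, so
    the comparison becomes an equality. *)
Lemma Rintegral_cos_normal_prob (t b : R) :
  \int[normal_prob 0 s]_x cos (t * x + b) = cos b * expR (- (s ^+ 2 * t ^+ 2 / 2)).
Proof.
pose psi b t := \int[leb]_x (cos (t * x + b) * phi x).
pose psi' b t := \int[leb]_x (- x * sin (t * x + b) * phi x).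
have mcos u b' : measurable_fun setT (fun x : R => cos (u * x + b')).
  apply: measurableT_comp; first exact: continuous_measurable_fun (@continuous_cos R).
  by apply: measurable_funD => //; exact: measurable_funM.
have msin u b' : measurable_fun setT (fun x : R => sin (u * x + b')).
  apply: measurableT_comp; first exact: continuous_measurable_fun (@continuous_sin R).
  by apply: measurable_funD => //; exact: measurable_funM.
have int_psi b' u : leb.-integrable setT (fun x => (cos (u * x + b') * phi x)%:E).
  apply: (@integrable_quadratic_normal _ 1) => // x.
  by apply: le_trans (cos_max _) _; rewrite mul1r lerDl sqr_ge0.
have dpsi b' (u : R) : is_derive u 1 (psi b') (psi' b' u).
  pose f (v x : R) := cos (v * x + b') * phi x.
  have df (v x : R) : is_derive v 1 (f ^~ x) (- x * sin (v * x + b') * phi x).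
    by rewrite /f; apply: is_derive_eq; rewrite /GRing.scale /=; ring.
  (* Dominates the derivative in the parameter uniformly, which permits differentiation under the
     integral. *)
  pose G x := `|x| * phi x.
  have intG : leb.-integrable setT (EFin \o G).
    apply: (@integrable_quadratic_normal _ 1); first exact: normr_measurable.
    by move=> x; rewrite normr_id mul1r; have := sqr_ge0 (`|x| - 1); rewrite -[x ^+ 2]real_normK ?num_real//; nra.
  have uI : `]u - 1, u + 1[%classic u by rewrite /= in_itv/=; lra.
  have G0 x : 0 <= G x by rewrite mulr_ge0 ?normal_pdf_ge0.
  have d1E v x : partial1of2 f v x = - x * sin (v * x + b') * phi x.
    by rewrite partial1of2E; exact: derive_val.
  have fG v x : `]u - 1, u + 1[%classic v -> setT x -> `|partial1of2 f v x| <= G x.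
    move=> _ _; rewrite d1E !normrM normrN (ger0_norm (normal_pdf_ge0 _ _ _)).
    by rewrite ler_wpM2r ?normal_pdf_ge0// ler_piMr// sin_max.
  have der v x : `]u - 1, u + 1[%classic v -> setT x -> derivable (f ^~ x) v 1.
    by move=> _ _; exact: ex_derive.
  have int_f v : `]u - 1, u + 1[%classic v -> leb.-integrable setT (EFin \o f v).
    by move=> _; exact: int_psi.
  split; first exact: (derivable_under_integral measurableT uI int_f der G0 intG fG).
  rewrite -derive1E (differentiation_under_integral measurableT uI int_f der G0 intG fG).
  by apply: eq_Rintegral => x _; rewrite d1E.
have ode b' u : psi' b' u + s ^+ 2 * u * psi b' u = 0.
  have parts := @normal_pdf_bounded_parts (fun x => sin (u * x + b'))
    (fun x => u * cos (u * x + b')) (1 + `|u|).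
  have -> : psi' b' u = - \int[leb]_x (x * sin (u * x + b') * phi x).
    rewrite /psi' -mulN1r -RintegralZl//; last first.
      apply: (@integrable_quadratic_normal (fun x => x * sin (u * x + b')) 1).
        exact: measurable_funM.
      move=> x; rewrite normrM mul1r; apply: (@le_trans _ _ `|x|).
        by rewrite ler_piMr// sin_max.
      by have := sqr_ge0 (`|x| - 1); rewrite -[x ^+ 2]real_normK ?num_real//; nra.
    by apply: eq_Rintegral => x _; rewrite mulN1r !mulNr.
  rewrite (parts _ _ _ _).
  - have -> : \int[leb]_x (u * cos (u * x + b') * phi x) = u * psi b' u.
      rewrite /psi -RintegralZl//; last exact: int_psi.
      by apply: eq_Rintegral => x _; rewrite mulrA.
    by ring.
  - by move=> x; apply: is_derive_eq; rewrite /GRing.scale /=; ring.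
  - move=> x; apply: cvgM; first exact: cvg_cst.
    apply: (@continuous_comp _ _ _ (fun x => u * x + b') cos); last exact: continuous_cos.
    by apply: cvgD; [apply: cvgM; [exact: cvg_cst|exact: cvg_id]|exact: cvg_cst].
  - by move=> x; apply: le_trans (sin_max _) _; rewrite lerDl.
  - move=> x; rewrite normrM; apply: (@le_trans _ _ `|u|); last by rewrite lerDr.
    by rewrite ler_piMr// cos_max.
have psi0 b' : psi b' 0 = cos b'.
  rewrite /psi; under eq_Rintegral do rewrite mul0r add0r.
  rewrite RintegralZl//; last exact: integrable_normal_pdf.
  by rewrite [X in _ * X]/Rintegral integral_normal_pdf mulr1.
have pos b' u : 0 <= u -> psi b' u = cos b' * expR (- (s ^+ 2 * u ^+ 2 / 2)).
  move=> u0; have := gaussian_ode (sqr_ge0 s) u0 (dpsi b').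
  move=> /(_ 0 _); rewrite mulr0 psi0 normr_le0 subr_eq0 => h; apply/eqP/h => v _.
  by rewrite ode normr0.
rewrite (@integral_normal_prob _ 1)//; last by move=> x; exact: cos_max.
(* A negative frequency is reduced to a positive one by changing the signs of both [t] and [b]. *)
have [t0|t0] := leP 0 t; first exact: pos.
have -> : \int[leb]_x (cos (t * x + b) * phi x) = psi (- b) (- t).
  by apply: eq_Rintegral => x _; rewrite -cosN opprD mulNr.
by rewrite pos ?oppr_ge0 ?ltW// cosN sqrrN.
Qed.

End GaussianCharacteristicFunction.

(** * The law of the random word *)

Section WordLaw.
Variables (R : realType) (S : finType) (disp : measure_display).
Variables (T : measurableType disp) (P : probability T R).
Variables (p : S -> S -> R) (pi : S -> R) (M : nat -> T -> S).
Hypothesis hM : markov_chain P p M.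
Hypothesis hM0 : initial_law P pi M.

Lemma measurable_path_event n x : measurable (path_event M n x).
Proof.
have [_ mM _] := hM.
have -> : path_event M n x = \bigcap_(k in [set k | (k <= n)%N]) (M k @^-1` [set x k]).
  by apply/seteqP; split.
by apply: bigcap_measurable; [exists 0%N|move=> k _; exact: mM].
Qed.

Lemma path_weight_rcons mu (l : seq S) s t :
  path_weight p mu (rcons (rcons l s) t) = path_weight p mu (rcons l s) * p s t.
Proof. by elim: l mu => [|r l IH] mu /=; rewrite ?mulr1// IH mulrA. Qed.

Lemma prob_path_event n x :
  P (path_event M n x) = (path_weight p pi (mkseq x n.+1))%:E.
Proof.
elim: n => [|n IH].
  rewrite /= mulr1 -hM0; congr (P _); apply/seteqP; split => t /=.
    by move=> /(_ 0%N); exact.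
  by move=> Mt k; rewrite leqn0 => /eqP ->.
have [_ _ ->] := hM; rewrite IH -EFinM; congr EFin.
by rewrite [in RHS]mkseqS mkseqS path_weight_rcons.
Qed.

(** Writes a function of the word as a finite combination of path indicators, which reduces its
    measurability and its expectation to path events. *)
Lemma random_word_indic (s0 : S) (F : seq S -> R) N t :
  F (random_word M N t) =
  \sum_(x : N.+1.-tuple S) F x * \1_(path_event M N (nth s0 x)) t.
Proof.
have sw : size (random_word M N t) == N.+1 by rewrite size_mkseq.
rewrite (bigD1 (Tuple sw)) //= big1 => [|x xw].
  rewrite indicE mem_set ?mulr1 ?addr0// => k kN.
  by rewrite nth_mkseq.
rewrite indicE memNset ?mulr0// => xt; move/eqP: xw; apply.
apply: val_inj; apply: (@eq_from_nth _ s0); first by rewrite size_tuple size_mkseq.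
move=> k; rewrite size_tuple => kN; rewrite nth_mkseq//.
by rewrite -xt// -ltnS.
Qed.

Lemma measurable_random_word (s0 : S) (F : seq S -> R) N :
  measurable_fun setT (fun t => F (random_word M N t)).
Proof.
under eq_fun do rewrite (random_word_indic s0).
apply: measurable_sum => x; apply: measurable_funM => //.
exact/measurable_indic/measurable_path_event.
Qed.

Lemma expectation_random_word (s0 : S) (F : seq S -> R) N :
  'E_P[fun t => F (random_word M N t)]%E = (chain_mean p pi N.+1 F)%:E.
Proof.
rewrite unlock; under eq_integral do rewrite (random_word_indic s0) -sumEFin.
rewrite integral_sum//=; last first.
  move=> x; under eq_fun do rewrite EFinM.
  exact/integrableZl/integrable_indic/measurable_path_event.
rewrite -sumEFin; apply: eq_bigr => x _.
under eq_integral do rewrite EFinM.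
rewrite integralZl//; last exact/integrable_indic/measurable_path_event.
rewrite integral_indic ?setIT//; last exact: measurable_path_event.
rewrite [X in (_ * X)%E](prob_path_event N (nth s0 x)) -EFinM mulrC; congr (_ * _)%:E; congr path_weight.
by have := mkseq_nth s0 (tval x); rewrite size_tuple.
Qed.

End WordLaw.

(** * The characteristic function of the normalized count *)

Section OccurrenceCounts.
Variables (R : realType) (S : finType) (p : S -> S -> R) (pi : S -> R).
Hypothesis p_stoch : stochastic p.
Hypothesis pi_distr : distr pi.
Hypothesis pi_inv : push p pi =1 pi.
Variables (s0 : S) (d : nat) (u : d.-tuple (seq S)) (n ell : nat) (delta : R).
Hypothesis contraction : forall g mu nu, (ell <= g)%N -> distr mu -> distr nu ->
  dist1 (iter g (push p) mu) (iter g (push p) nu) <= delta.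
Variable a : R.
Hypothesis a_gt0 : 0 < a.

Local Notation E := (chain_mean p pi n).
Local Notation L := (total_size u).
Implicit Types I J : d.-tuple 'I_n.+1.

Let occ I (x : seq S) : R := (occurs_at 0 u (map val I) x)%:R.
Let dev I x : R := occ I x - E (occ I).
Let nb I : {set d.-tuple 'I_n.+1} := [set J : d.-tuple 'I_n.+1 | near_cover ell u (map val I) (map val J)]%SET.

Definition centered_count (x : seq S) : R :=
  ((occurrences u x)%:R - E (fun y => (occurrences u y)%:R)) / a.

Let occurrences_sum x : size x = n -> (occurrences u x)%:R = \sum_I occ I x.
Proof.
move=> xn; rewrite occurrencesE xn -sum1_card natr_sum.
rewrite big_mkcond /=; apply: eq_bigr => I _; rewrite inE /occ.
by case: occurs_at.
Qed.

Let centered_count_sum x : size x = n ->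
  centered_count x = (\sum_(I | I \notin finset.set0) dev I x) / a.
Proof.
move=> xn; rewrite /centered_count; congr (_ / a).
have -> : E (fun y => (occurrences u y)%:R) = \sum_I E (occ I).
  by rewrite -chain_mean_sum; apply: eq_chain_mean => y; exact: occurrences_sum.
rewrite [RHS](eq_bigl xpredT); last by move=> I; rewrite finset.in_set0.
by rewrite sumrB occurrences_sum.
Qed.

Let occ01 I x : 0 <= occ I x <= 1.
Proof. by rewrite /occ; case: occurs_at; rewrite ?lexx ler01. Qed.

Let E_dev I : E (dev I) = 0.
Proof.
rewrite /dev /chain_mean wmeanB wmean_cst ?subrr//; exact: sum_path_weight.
Qed.

Let dev_le1 I x : `|dev I x| <= 1.
Proof.
have h : 0 <= E (occ I) <= 1.
  have w0 (y : n.-tuple S) : 0 <= path_weight p pi y by exact: path_weight_ge0.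
  have w1 := sum_path_weight p_stoch n pi_distr.
  have ge0 := @ler_wmean _ _ _ w0 (fun=> 0) (fun x => occ I (val x))
    (fun y => proj1 (andP (occ01 I _))).
  have le1 := @ler_wmean _ _ _ w0 (fun x => occ I (val x)) (fun=> 1)
    (fun y => proj2 (andP (occ01 I _))).
  by rewrite !wmean_cst// in ge0 le1; apply/andP.
by have := occ01 I x; rewrite /dev ler_norml; lra.
Qed.

Let dev_reads I (A : pred nat) : (forall k, k \in cover u (map val I) -> A k) ->
  reads_only n A (dev I).
Proof.
move=> IA r x y xn yn xy; rewrite /dev /occ; congr (_%:R - _).
congr nat_of_bool; apply: (@occurs_at_cover _ r); first by rewrite xn yn.
by move=> k kI; apply: xy; exact: IA.
Qed.

Let count_mem_iota (s : seq nat) : (count (mem s) (iota 0 n) <= size s)%N.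
Proof.
rewrite -size_filter; apply: uniq_leq_size; first by rewrite filter_uniq ?iota_uniq.
by move=> k; rewrite mem_filter => /andP[].
Qed.

Let out (A : {set d.-tuple 'I_n.+1}) (x : seq S) : R :=
  (\sum_(I | I \notin A) dev I x) / a.

(** Gives the form in which [chain_mean_mixing] wants the partial sum: it reads only positions far
    from all of [s]. *)
Let out_reads (s : seq nat) (A : {set d.-tuple 'I_n.+1}) (g : R -> R) :
  (forall J, J \notin A -> forall j k, j \in s -> k \in cover u (map val J) -> far ell j k) ->
  reads_only n [pred k | all (fun j => far ell j k) s] (fun x => g (out A x)).
Proof.
move=> As r x y xn yn xy; congr (g (_ / a)); apply: eq_bigr => J JA.
apply: (@dev_reads J [pred k | all (fun j => far ell j k) s] _ r) => // k kJ.
by apply/allP => j js; exact: As JA _ _ js kJ.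
Qed.

Let far_out (s : seq nat) j k : j \in s -> all (fun j => far ell j k) s ->
  (j + ell < k)%N || (k + ell < j)%N.
Proof. by move=> js /allP/(_ j js). Qed.

Let delta0 : 0 <= delta.
Proof. exact: (delta_ge0 contraction pi_distr). Qed.

(** The deviation has mean 0, so the product of means vanishes. The constant is the one of [mix2],
    where two covers are read; a single cover would give half of it. *)
Let mix1 I (g : R -> R) B : (forall y, `|g y| <= B) ->
  `|E (fun x => dev I x * g (out (nb I) x))| <= delta * L.*2.*2%:R * B.
Proof.
move=> gB; have B0 : 0 <= B by exact: le_trans (gB 0).
have := @chain_mean_mixing _ _ _ p_stoch _ _ contraction s0 pi n
  [pred k | k \in cover u (map val I)]
  [pred k | all (fun j => far ell j k) (cover u (map val I))] L
  (dev I) (fun x => g (out (nb I) x)) 1 B pi_distr pi_inv.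
rewrite E_dev mul0r subr0 mul1r => h; apply: le_trans (h _ _ _ _ _ _) _.
- exact: dev_reads.
- by apply: out_reads => J; rewrite inE => JI j k jI kJ; exact: near_coverN JI jI kJ.
- exact: dev_le1.
- by move=> x; exact: gB.
- by move=> j k; exact: far_out.
- exact: leq_trans (count_mem_iota _) (size_cover _ _).
by rewrite mulrAC ler_wpM2r// ler_wpM2l// ler_nat; lia.
Qed.

Let mix2 I J (g : R -> R) B : (forall y, `|g y| <= B) ->
  `|E (fun x => dev I x * dev J x * g (out (nb I :|: nb J) x))
    - E (fun x => dev I x * dev J x) * E (fun x => g (out (nb I :|: nb J) x))|
  <= delta * L.*2.*2%:R * B.
Proof.
move=> gB; have B0 : 0 <= B by exact: le_trans (gB 0).
pose s := cover u (map val I) ++ cover u (map val J).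
have := @chain_mean_mixing _ _ _ p_stoch _ _ contraction s0 pi n
  [pred k | k \in s] [pred k | all (fun j => far ell j k) s] L.*2
  (fun x => dev I x * dev J x) (fun x => g (out (nb I :|: nb J) x)) 1 B pi_distr pi_inv.
rewrite mul1r => h; apply: le_trans (h _ _ _ _ _ _) _.
- move=> r x y xn yn xy; congr (_ * _); apply: (@dev_reads _ _ _ r x y xn yn xy) => k kI;
    by rewrite inE mem_cat kI ?orbT.
- apply: out_reads => K; rewrite !inE negb_or => /andP[KI KJ] j k.
  rewrite mem_cat => /orP[jI|jJ] kK; first exact: near_coverN KI jI kK.
  exact: near_coverN KJ jJ kK.
- by move=> x; rewrite normrM mulr_ile1.
- by move=> x; exact: gB.
- by move=> j k; exact: far_out.
- apply: leq_trans (count_mem_iota _) _; rewrite size_cat -addnn.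
  by apply: leq_add; exact: size_cover.
by rewrite mulrAC.
Qed.

Let mix3 I J : J \notin nb I -> `|E (fun x => dev I x * dev J x)| <= delta * L.*2.*2%:R.
Proof.
rewrite inE => JI.
have := @chain_mean_mixing _ _ _ p_stoch _ _ contraction s0 pi n
  [pred k | k \in cover u (map val I)]
  [pred k | all (fun j => far ell j k) (cover u (map val I))] L
  (dev I) (dev J) 1 1 pi_distr pi_inv.
rewrite E_dev mul0r subr0 !mul1r => h; apply: le_trans (h _ _ _ _ _ _) _.
- exact: dev_reads.
- apply: dev_reads => k kJ; apply/allP => /= j jI; exact: near_coverN JI jI kJ.
- exact: dev_le1.
- exact: dev_le1.
- by move=> j k; exact: far_out.
- exact: leq_trans (count_mem_iota _) (size_cover _ _).
by rewrite mulr1 ler_wpM2l// ler_nat; lia.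
Qed.

Lemma centered_count_stein (f f' : R -> R) (B0 B1 B2 e D m : R) :
  (forall y, `|f y| <= B0) -> (forall y, `|f' y| <= B1) ->
  (forall y h, `|f (y + h) - f y - f' y * h| <= B2 * h ^+ 2) ->
  (forall y h, `|f' (y + h) - f' y| <= B2 * `|h|) ->
  e = delta * L.*2.*2%:R -> D = (ell.*2.+1 * L ^ 2 * n.+1 ^ d.-1)%:R ->
  m = (n.+1 ^ d)%:R ->
  `|E (fun x => centered_count x * f (centered_count x))
    - E (fun x => centered_count x ^+ 2) * E (fun x => f' (centered_count x))|
  <= m / a *
     (e * B0 + 4 * B2 * (D / a) ^+ 2 + (D / a) * (e * B1) + m / a * (e * B1)).
Proof.
move=> fB0 f'B1 fB2 f'B2 -> -> ->.
have := @stein_estimate _ _ (fun x : n.-tuple S => path_weight p pi x)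
  (fun x => path_weight_ge0 p_stoch x pi_distr) (sum_path_weight p_stoch n pi_distr)
  _ (fun I x => dev I (tval x)) nb a _ _ (fun I x => dev_le1 I x) a_gt0 _
  mix1 mix2 mix3 f f' B0 B1 B2 fB0 f'B1 fB2 f'B2.
rewrite card_tuple card_ord => h.
have -> : E (fun x => centered_count x * f (centered_count x)) =
    E (fun x => out finset.set0 x * f (out finset.set0 x)).
  by apply: eq_chain_mean => x xn; rewrite centered_count_sum.
have -> : E (fun x => centered_count x ^+ 2) = E (fun x => out finset.set0 x ^+ 2).
  by apply: eq_chain_mean => x xn; rewrite centered_count_sum.
have -> : E (fun x => f' (centered_count x)) = E (fun x => f' (out finset.set0 x)).
  by apply: eq_chain_mean => x xn; rewrite centered_count_sum.
apply: h => I; rewrite ler_nat; exact: card_near_cover.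
Qed.

End OccurrenceCounts.

Section TrigonometricEstimates.
Variable R : realType.

Lemma mean_value (f f' : R -> R) : (forall x : R, is_derive x 1 f (f' x)) ->
  forall x y, exists2 z, `|z - x| <= `|y - x| & f y - f x = f' z * (y - x).
Proof.
move=> df x y.
have cf (a b : R) : {within `[a, b], continuous f}.
  by apply: derivable_within_continuous => z _; exact: ex_derive.
have [xy|yx] := leP x y.
  have [z] := MVT_segment xy (fun z _ => df z) (cf x y).
  rewrite in_itv /= => /andP[xz zy] fE; exists z => //.
  by rewrite !ger0_norm ?subr_ge0// lerD2r.
have [z] := MVT_segment (ltW yx) (fun z _ => df z) (cf y x).
rewrite in_itv /= => /andP[yz zx] fE; exists z.
  by rewrite distrC [leRHS]distrC !ger0_norm ?subr_ge0 ?(ltW yx)// lerD2l lerN2.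
by rewrite -[LHS]opprB fE -mulrN opprB.
Qed.

Lemma cos_lipschitz (x y : R) : `|cos y - cos x| <= `|y - x|.
Proof.
have [z _ ->] := mean_value (@is_derive_cos R) x y.
by rewrite normrM normrN ler_piMl// sin_max.
Qed.

Lemma sin_taylor (x h : R) : `|sin (x + h) - sin x - cos x * h| <= h ^+ 2.
Proof.
have [z zx ->] := mean_value (@is_derive_sin R) x (x + h).
rewrite addrAC subrr add0r in zx *.
rewrite -mulrBl normrM -[leRHS]ger0_norm ?sqr_ge0// normrX expr2.
by rewrite ler_wpM2r// (le_trans (cos_lipschitz _ _)).
Qed.

Lemma is_derive_wmean (Omega : finType) (w : Omega -> R)
    (c c' : R -> Omega -> R) (t : R) :
  (forall x, is_derive t 1 (c ^~ x) (c' t x)) ->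
  is_derive t 1 (fun s => wmean w (c s)) (wmean w (c' t)).
Proof.
move=> dc; rewrite /wmean.
have -> : (fun s => \sum_x w x * c s x) = \sum_x (fun s => w x * c s x).
  by apply/funext => s; rewrite fct_sumE.
apply: (big_ind2 (fun (g : R -> R) (dg : R) => is_derive t 1 g dg)).
- exact: is_derive_cst.
- by move=> g dg h dh ? ?; exact: is_deriveD.
- by move=> x _; have dcx := dc x; exact: is_deriveZ.
Qed.

End TrigonometricEstimates.

Section CountCharacteristicFunction.
Variables (R : realType) (S : finType) (p : S -> S -> R) (pi : S -> R).
Hypothesis p_stoch : stochastic p.
Hypothesis pi_distr : distr pi.
Hypothesis pi_inv : push p pi =1 pi.
Variables (s0 : S) (d : nat) (u : d.-tuple (seq S)) (n ell : nat) (delta : R).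
Hypothesis contraction : forall g mu nu, (ell <= g)%N -> distr mu -> distr nu ->
  dist1 (iter g (push p) mu) (iter g (push p) nu) <= delta.
Variable a : R.
Hypothesis a_gt0 : 0 < a.

Local Notation E := (chain_mean p pi n).
Local Notation Y := (centered_count p pi u n a).

Lemma chain_mean_cos_centered_count (t b e D m : R) : 0 <= t ->
  e = delta * (total_size u).*2.*2%:R ->
  D = (ell.*2.+1 * total_size u ^ 2 * n.+1 ^ d.-1)%:R -> m = (n.+1 ^ d)%:R ->
  `|E (fun x => cos (t * Y x + b))
    - cos b * expR (- (E (fun x => Y x ^+ 2) * t ^+ 2 / 2))|
  <= t * (m / a * (e + 4 * t ^+ 2 * (D / a) ^+ 2 + D / a * (e * t) + m / a * (e * t))).
Proof.
move=> t0 eE DE mE.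
pose c s := E (fun x => cos (s * Y x + b)).
pose c' s := E (fun x => - Y x * sin (s * Y x + b)).
have dc (s : R) : is_derive s 1 c (c' s).
  apply: (@is_derive_wmean _ _ (fun x : n.-tuple S => path_weight p pi x)
    (fun s x => cos (s * Y x + b)) (fun s x => - Y x * sin (s * Y x + b))) => x.
  apply: is_derive_eq.
  by rewrite /GRing.scale /=; ring.
set v := E (fun x => Y x ^+ 2).
have v0 : 0 <= v.
  apply: sumr_ge0 => x _; rewrite mulr_ge0 ?sqr_ge0//.
  exact: (path_weight_ge0 p_stoch _ pi_distr).
have -> : cos b = c 0.
  rewrite /c -[LHS](chain_mean_cst p_stoch n (cos b) pi_distr).
  by apply: eq_chain_mean => x _; rewrite mul0r add0r.
apply: (@gaussian_ode _ c c') => // s /andP[s_ge0 st].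
(* For [f y = sin (s * y + b)] the Stein difference is [- (c' s + v * s * c s)]. The bounds [1], [t]
   and [t ^+ 2] are uniform over [s] in [[0, t]]. *)
have stein := @centered_count_stein _ _ _ _ p_stoch pi_distr pi_inv s0 d u n ell
  delta contraction a a_gt0 (fun y => sin (s * y + b)) (fun y => s * cos (s * y + b))
  1 t (t ^+ 2) e D m _ _ _ _ eE DE mE.
have -> : c' s + v * s * c s = - (E (fun x => Y x * sin (s * Y x + b))
    - v * E (fun x => s * cos (s * Y x + b))).
  rewrite chain_meanZl opprB [RHS]addrC mulrA; congr (_ + _).
  rewrite /c' -mulN1r -chain_meanZl; apply: eq_chain_mean => x _.
  by rewrite mulrA mulN1r.
rewrite normrN; apply: le_trans (stein _ _ _ _) _; last by rewrite mulr1.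
- by move=> y; exact: sin_max.
- move=> y; rewrite normrM (ger0_norm s_ge0) -[leRHS]mulr1.
  by apply: ler_pM => //; exact: cos_max.
- move=> y h; have -> : s * (y + h) + b = (s * y + b) + s * h by ring.
  have -> : s * cos (s * y + b) * h = cos (s * y + b) * (s * h) by ring.
  apply: le_trans (sin_taylor _ _) _; rewrite exprMn ler_wpM2r ?sqr_ge0//.
  by rewrite lerXn2r ?nnegrE.
- move=> y h; rewrite -mulrBr normrM (ger0_norm s_ge0) expr2 -mulrA.
  apply: ler_pM => //; apply: le_trans (cos_lipschitz _ _) _.
  have -> : s * (y + h) + b - (s * y + b) = s * h by ring.
  by rewrite normrM (ger0_norm s_ge0) ler_wpM2r.
Qed.

End CountCharacteristicFunction.

(** * Orders of magnitude: choice of the gap and size of the error *)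

Section Asymptotics.
Variable R : realType.

(* The error term of the Stein estimate, where [x] and [y] stand for the number of
   summands and for the size of a neighbourhood, both divided by the
   normalization, [r] for the square root of [N] and [w] for the gap. *)
Lemma stein_error_small (t kappa c1 c2 h x y e r w : R) :
  0 <= t -> 0 <= kappa -> 0 <= c1 -> 0 <= c2 -> 0 <= h <= 1 ->
  0 <= x <= kappa * r -> 0 <= y -> r * y <= c2 * w -> 1 <= w -> w ^+ 2 <= h * r ->
  0 <= e -> r ^+ 2 * e <= c1 * h -> 1 <= r ->
  t * (x * (e + 4 * t ^+ 2 * y ^+ 2 + y * (e * t) + x * (e * t))) <=
  t * (kappa * c1 + 4 * t ^+ 2 * (kappa * c2 ^+ 2) + t * (kappa * (c2 * c1))
       + t * (kappa ^+ 2 * c1)) * h.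
Proof.
move=> t0 kappa0 c10 c20 /andP[h0 h1] /andP[x0 xr] y0 ryw w1 wr e0 re r1.
have r0 : 0 < r by exact: lt_le_trans r1.
have re1 : r * e <= c1 * h.
  by apply: le_trans re; rewrite ler_wpM2r// expr2 ler_peMr// ltW.
have xe : x * e <= kappa * c1 * h.
  apply: (@le_trans _ _ (kappa * r * e)); first by rewrite ler_wpM2r.
  by rewrite -!mulrA ler_wpM2l.
(* The Taylor remainders: here the gap must be small against the fourth root of [N]. *)
have ry2 : r * y ^+ 2 <= c2 ^+ 2 * h.
  rewrite -(ler_pM2l r0); apply: (@le_trans _ _ ((r * y) ^+ 2)).
    by rewrite le_eqVlt; apply/orP; left; apply/eqP; ring.
  apply: (@le_trans _ _ ((c2 * w) ^+ 2)).
    by rewrite lerXn2r ?nnegrE// mulr_ge0// ltW// (lt_le_trans ltr01).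
  rewrite exprMn; have -> : r * (c2 ^+ 2 * h) = c2 ^+ 2 * (h * r) by ring.
  by rewrite ler_wpM2l// sqr_ge0.
have xy2 : x * y ^+ 2 <= kappa * c2 ^+ 2 * h.
  apply: (@le_trans _ _ (kappa * r * y ^+ 2)); first by rewrite ler_wpM2r ?sqr_ge0.
  by rewrite -[leLHS]mulrA -[leRHS]mulrA ler_wpM2l.
have xye : x * y * e <= kappa * (c2 * c1) * h.
  apply: (@le_trans _ _ (kappa * (r * y) * e)).
    by rewrite ler_wpM2r// mulrA ler_wpM2r.
  rewrite -!mulrA ler_wpM2l// mulrA.
  apply: (@le_trans _ _ (c2 * (h * r) * e)).
    rewrite ler_wpM2r//; apply: le_trans ryw _; rewrite ler_wpM2l//.
    by apply: le_trans wr; rewrite expr2 ler_peMr// (le_trans ler01).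
  rewrite -!mulrA ler_wpM2l//; apply: (@le_trans _ _ (h * (c1 * h))).
    by rewrite ler_wpM2l.
  by rewrite ler_piMl// mulr_ge0.
(* The distant covariances: here [N * e] must be small. *)
have xxe : x * x * e <= kappa ^+ 2 * c1 * h.
  apply: (@le_trans _ _ ((kappa * r) * (kappa * r) * e)).
    by rewrite ler_wpM2r// ler_pM.
  have -> : kappa * r * (kappa * r) * e = kappa ^+ 2 * (r ^+ 2 * e) by ring.
  by rewrite -mulrA ler_wpM2l// sqr_ge0.
rewrite -[leRHS]mulrA ler_wpM2l//.
have -> : x * (e + 4 * t ^+ 2 * y ^+ 2 + y * (e * t) + x * (e * t)) =
  x * e + 4 * t ^+ 2 * (x * y ^+ 2) + t * (x * y * e) + t * (x * x * e) by ring.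
have h2 := ler_wpM2l (_ : 0 <= 4 * t ^+ 2) xy2; have h3 := ler_wpM2l t0 xye.
have h4 := ler_wpM2l t0 xxe.
have {}h2 : 4 * t ^+ 2 * (x * y ^+ 2) <= 4 * t ^+ 2 * (kappa * c2 ^+ 2 * h).
  by apply: h2; rewrite mulr_ge0 ?sqr_ge0.
by move: xe h2 h3 h4; lra.
Qed.

Lemma expr_le_quarter (rho : R) : 0 <= rho -> rho < 1 ->
  exists K, rho ^+ K <= 1 / 4.
Proof.
move=> r0 r1; have rho1 : `|rho| < 1 by rewrite ger0_norm.
have q0 : 0 < 1 / 4 :> R by rewrite divr_gt0.
have /cvgrPdist_le/(_ _ q0)[K _ /(_ K (leqnn K))] /= := cvg_expr rho1.
rewrite sub0r normrN => hK; exists K; exact: le_trans (ler_norm _) hK.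
Qed.

(* [k] is a multiple of [log N]. *)
Lemma scale_choice (rho eta : R) : 0 <= rho -> rho < 1 -> 0 < eta ->
  \forall N \near \oo, exists k : nat,
    N%:R * rho ^+ k <= eta /\ k.+1%:R ^+ 2 <= eta * Num.sqrt N%:R.
Proof.
move=> rho0 rho1 eta0; have [K hK] := expr_le_quarter rho0 rho1.
pose q := Num.bound (64 * K.+1%:R ^+ 2 / eta).
pose N1 := Num.bound (4 / eta).
exists (maxn (maxn (2 ^ (8 * q)) N1) 1) => // N /=.
rewrite !geq_max -andbA => /and3P[Nq NN1 N_gt0].
have [l_lo l_hi] : (2 ^ trunc_log 2 N <= N)%N /\ (N < 2 ^ (trunc_log 2 N).+1)%N.
  by have /andP[] := trunc_log_bounds (isT : 1 < 2)%N N_gt0.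
have ql : (8 * q <= trunc_log 2 N)%N by exact: trunc_log_max.
set l := trunc_log 2 N in l_lo l_hi ql.
(* As [rho ^+ K <= 1 / 4], the power [rho ^+ (K * l)] is at most [4^-l <= 4 / N^2], which beats the
   factor [N]. *)
exists (K * l)%N; split.
  have p2 : 0 < 2 ^+ l :> R by rewrite exprn_gt0.
  apply: (@le_trans _ _ (N%:R * (1 / 4) ^+ l)).
    by rewrite ler_wpM2l// exprM lerXn2r ?nnegrE ?exprn_ge0// divr_ge0.
  have -> : (1 / 4 : R) ^+ l = (2 ^+ l * 2 ^+ l)^-1.
    by rewrite div1r exprVn -exprMn -natrM.
  have Nl : N%:R <= 2 * 2 ^+ l :> R by rewrite -exprS -natrX ler_nat ltnW.
  have N0 : 0 < N%:R :> R by rewrite ltr0n.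
  apply: (@le_trans _ _ (4 / N%:R)).
    rewrite ler_pdivrMr ?mulr_gt0// mulrAC ler_pdivlMr//.
    have -> : 4 * (2 ^+ l * 2 ^+ l) = (2 * 2 ^+ l) * (2 * 2 ^+ l) :> R by ring.
    by apply: ler_pM.
  rewrite ler_pdivrMr// mulrC -ler_pdivrMr//.
  apply: le_trans (ltW (archi_boundP (divr_ge0 _ (ltW eta0)))) _ => //.
  by rewrite ler_nat.
(* [J] is comparable to [log N], and [J <= 2 ^ (l %/ 8)] gives [J ^ 8 <= N], that is
   [J^4 <= sqrt N]. Since [k + 1 <= 8 (K + 1) J], it remains to have [64 (K + 1)^2 <= eta J^2],
   which [q <= J] provides. *)
pose J := (l %/ 8).+1.
have lJ : (l.+1 <= 8 * J)%N by rewrite /J; lia.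
have qJ : (q <= J)%N by rewrite /J; lia.
have J8 : (J ^ 8 <= N)%N.
  apply: leq_trans l_lo; apply: (@leq_trans ((2 ^ (l %/ 8)) ^ 8)).
    by rewrite leq_exp2r//; exact: ltn_expl.
  by rewrite -expnM leq_exp2l//; lia.
have J4 : J%:R ^+ 4 <= Num.sqrt N%:R :> R.
  rewrite -[leLHS]ger0_norm ?exprn_ge0// -sqrtr_sqr ler_wsqrtr// -exprM -natrX ler_nat//.
have kJ : ((K * l).+1 <= 8 * K.+1 * J)%N by nia.
apply: (@le_trans _ _ (64 * K.+1%:R ^+ 2 * J%:R ^+ 2)).
  have -> : 64 * K.+1%:R ^+ 2 * J%:R ^+ 2 = ((8 * K.+1 * J)%N%:R) ^+ 2 :> R.
    by rewrite !natrM; ring.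
  by rewrite lerXn2r ?nnegrE// ler_nat.
apply: (@le_trans _ _ (eta * J%:R ^+ 4)); last by rewrite ler_wpM2l// ltW.
have -> : eta * J%:R ^+ 4 = eta * J%:R ^+ 2 * J%:R ^+ 2 by ring.
rewrite ler_wpM2r ?sqr_ge0// -ler_pdivrMl// [leLHS]mulrC.
apply: le_trans (ltW (archi_boundP (divr_ge0 _ (ltW eta0)))) _.
  by rewrite mulr_ge0// sqr_ge0.
apply: (@le_trans _ _ J%:R); first by rewrite ler_nat.
by rewrite expr2 ler_peMr// ler1n.
Qed.

End Asymptotics.

Section Normalization.
Variable R : realType.

Lemma powR_scale (d N : nat) : (0 < N)%N ->
  (N%:R : R) `^ (d%:R - 2^-1) = N%:R ^+ d / Num.sqrt N%:R.
Proof.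
move=> N0; have N0' : (N%:R : R) != 0 by rewrite pnatr_eq0 -lt0n.
by rewrite powRB ?N0' ?implybT// powR_mulrn ?powR12_sqrt.
Qed.

Lemma powR_scale_sqr (d N : nat) :
  ((N%:R : R) `^ (d%:R - 2^-1)) ^+ 2 = N%:R `^ (2 * d%:R - 1).
Proof.
rewrite -powR_mulrn ?powR_ge0// -powRrM; congr (_ `^ _).
by rewrite mulrBl mulVf ?pnatr_eq0// mulrC.
Qed.

(** A word of [N + 1] letters has [N + 2] starting positions, and [N + 2 <= 3 N]. *)
Lemma card_scale_le (d N : nat) : (0 < N)%N ->
  0 <= (N.+2 ^ d)%:R / (N%:R : R) `^ (d%:R - 2^-1) <= 3 ^+ d * Num.sqrt N%:R.
Proof.
move=> N0; have N0' : 0 < (N%:R : R) by rewrite ltr0n.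
have Nd : 0 < (N%:R : R) ^+ d by rewrite exprn_gt0.
rewrite divr_ge0 ?powR_ge0//= powR_scale// invf_div mulrA ler_pdivrMr//.
rewrite mulrAC ler_wpM2r ?sqrtr_ge0// -exprMn -natrM -natrX ler_nat.
by case: d {Nd} => // d; rewrite leq_exp2r//; lia.
Qed.

(** For [d = 0] the exponent [d.-1] is truncated to 0, and the vanishing of [L] makes up for it. *)
Lemma neighbours_scale_le (d N L m k : nat) : (0 < N)%N -> (d = 0 -> L = 0)%N ->
  0 <= ((m * k).*2.+1 * L ^ 2 * N.+2 ^ d.-1)%:R / (N%:R : R) `^ (d%:R - 2^-1) /\
  Num.sqrt N%:R * (((m * k).*2.+1 * L ^ 2 * N.+2 ^ d.-1)%:R / (N%:R : R) `^ (d%:R - 2^-1))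
    <= (L ^ 2 * 3 ^ d * m.*2.+1)%:R * k.+1%:R.
Proof.
move=> N0 d0; have N0' : 0 < (N%:R : R) by rewrite ltr0n.
have Nd : 0 < (N%:R : R) ^+ d by rewrite exprn_gt0.
split; first by rewrite divr_ge0 ?powR_ge0.
rewrite powR_scale// invf_div [X in _ * X]mulrA mulrA ler_pdivrMr// mulrCA.
rewrite -expr2 sqr_sqrtr// -!natrM -natrX -natrM ler_nat.
case: d d0 Nd => [|d] d0 Nd; first by rewrite d0// exp0n// muln0 !mul0n.
have N3 : (N.+2 ^ d <= 3 ^ d * N ^ d)%N.
  rewrite -expnMn; case: d {d0 Nd} => // d; rewrite leq_exp2r//; lia.
have Nd3 : (N.+2 ^ d * N <= 3 ^ d.+1 * N ^ d.+1)%N.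
  rewrite !expnSr mulnA leq_mul2r; apply/orP; right.
  by apply: leq_trans N3 _; rewrite leq_mul2r leq_pmulr ?orbT.
have mk : ((m * k).*2.+1 <= m.*2.+1 * k.+1)%N by nia.
apply: (@leq_trans (m.*2.+1 * k.+1 * L ^ 2 * (3 ^ d.+1 * N ^ d.+1))%N).
  by rewrite -mulnA; apply: leq_mul => //; apply: leq_mul.
by rewrite leq_eqVlt; apply/orP; left; apply/eqP; ring.
Qed.

End Normalization.

Section CountConvergence.
Variables (R : realType) (S : finType) (p : S -> S -> R) (pi : S -> R).
Hypothesis p_stoch : stochastic p.
Hypothesis p_irr : irreducible p.
Hypothesis p_aper : aperiodic p.
Hypothesis pi_stat : stationary p pi.
Variables (s0 : S) (d : nat) (u : d.-tuple (seq S)).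

Local Notation Y N := (centered_count p pi u N.+1 (N%:R `^ (d%:R - 2^-1))).

Lemma cvg_chain_mean_cos (sigma t b : R) :
  chain_mean p pi N.+1 (fun x => Y N x ^+ 2) @[N --> \oo] --> sigma ^+ 2 ->
  chain_mean p pi N.+1 (fun x => cos (t * Y N x + b)) @[N --> \oo] -->
    cos b * expR (- (sigma ^+ 2 * t ^+ 2 / 2)).
Proof.
move=> v_cvg; have [pi_ge0 pi_sum pi_inv] := pi_stat.
wlog t0 : t b / 0 <= t.
  move=> wl; have [t0|t0] := leP 0 t; first exact: wl.
  have := wl (- t) (- b); rewrite oppr_ge0 (ltW t0) sqrrN cosN => /(_ isT).
  have /funext -> // : forall N, chain_mean p pi N.+1 (fun x => cos (- t * Y N x + - b)) =
      chain_mean p pi N.+1 (fun x => cos (t * Y N x + b)).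
  by move=> N; apply: eq_chain_mean => x _; rewrite mulNr -opprD cosN.
pose v N := chain_mean p pi N.+1 (fun x => Y N x ^+ 2).
(* The Gaussian value with the actual variance: Stein's estimate compares with it, and it converges
   together with [v N]. *)
pose w N := cos b * expR (- (v N * t ^+ 2 / 2)).
have w_cvg : w N @[N --> \oo] --> cos b * expR (- (sigma ^+ 2 * t ^+ 2 / 2)).
  apply: cvgM; first exact: cvg_cst.
  apply: (cvg_comp _ expR); last exact: continuous_expR.
  apply: cvgN; apply: cvgM; last exact: cvg_cst.
  by apply: cvgM; [exact: v_cvg|exact: cvg_cst].
have [m [rho [rho0 rho1 contr]]] := dist1_contraction p_stoch p_irr p_aper s0.
pose L := total_size u; pose kappa : R := 3 ^+ d; pose c1 : R := 2 * L.*2.*2%:R.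
pose c2 : R := (L ^ 2 * 3 ^ d * m.*2.+1)%:R.
pose A := t * (kappa * c1 + 4 * t ^+ 2 * (kappa * c2 ^+ 2) + t * (kappa * (c2 * c1))
       + t * (kappa ^+ 2 * c1)).
have kappa0 : 0 <= kappa by rewrite exprn_ge0.
have c10 : 0 <= c1 by rewrite mulr_ge0.
have c20 : 0 <= c2 by [].
have A0 : 0 <= A.
  by rewrite mulr_ge0// !addr_ge0// !mulr_ge0// ?sqr_ge0// ?mulr_ge0// ?sqr_ge0.
apply/cvgrPdist_le => eps eps0; have eps2 : 0 < eps / 2 by rewrite divr_gt0.
(* [A * h] bounds the Stein error and gets half of [eps]; [A + 1] replaces [A] lest it vanish. *)
pose h := Num.min 1 (eps / 2 / (A + 1)).
have A1 : 0 < A + 1 by rewrite ltr_wpDl.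
have h0 : 0 < h by rewrite lt_min ltr01 divr_gt0.
have h1 : h <= 1 by rewrite ge_min lexx.
have Ah : A * h <= eps / 2.
  apply: (@le_trans _ _ ((A + 1) * h)); first by rewrite ler_wpM2r ?(ltW h0)// lerDl.
  by rewrite mulrC -ler_pdivlMr// ge_min lexx orbT.
have scale := scale_choice rho0 rho1 h0.
move/cvgrPdist_le: w_cvg => /(_ _ eps2) w_near.
near=> N.
have N0 : (0 < N)%N by near: N; exact: nbhs_infty_gt.
have [k [Nk kN]] : exists k : nat,
    N%:R * rho ^+ k <= h /\ k.+1%:R ^+ 2 <= h * Num.sqrt N%:R by near: N.
have w_close : `|cos b * expR (- (sigma ^+ 2 * t ^+ 2 / 2)) - w N| <= eps / 2 by near: N.
have a0 : 0 < (N%:R : R) `^ (d%:R - 2^-1) by rewrite powR_gt0// ltr0n.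
have := @chain_mean_cos_centered_count _ _ _ _ p_stoch (conj pi_ge0 pi_sum) pi_inv
  s0 d u N.+1 (m * k) (2 * rho ^+ k) (contr k) _ a0 t b _ _ _ t0 erefl erefl erefl.
rewrite -/(v N) -/(w N) => close.
have d0 : (d = 0 -> total_size u = 0)%N.
  by case: d u => // u' _; rewrite /total_size (tuple0 u') big_nil.
have [y0 y_le] := @neighbours_scale_le R d N L m k N0 d0.
have r1 : 1 <= Num.sqrt (N%:R : R).
  by rewrite -[leLHS]sqrtr1 ler_wsqrtr// ler1n.
have e0 : 0 <= 2 * rho ^+ k * L.*2.*2%:R by rewrite !mulr_ge0// exprn_ge0.
have re : Num.sqrt (N%:R : R) ^+ 2 * (2 * rho ^+ k * L.*2.*2%:R) <= c1 * h.
  rewrite sqr_sqrtr//.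
  have -> : N%:R * (2 * rho ^+ k * L.*2.*2%:R) = c1 * (N%:R * rho ^+ k).
    by rewrite /c1; ring.
  by rewrite ler_wpM2l.
have h01 : 0 <= h <= 1 by rewrite (ltW h0).
have w1 : 1 <= (k.+1%:R : R) by rewrite ler1n.
have small := @stein_error_small R t kappa c1 c2 h _ _ _ _ _ t0 kappa0 c10 c20 h01
  (@card_scale_le R d N N0) y0 y_le w1 kN e0 re r1.
have {}close := le_trans (le_trans close small) Ah.
rewrite distrC; have -> : eps = eps / 2 + eps / 2 by rewrite -splitr.
apply: le_trans (ler_distD (w N) _ _) _; apply: lerD => //.
by rewrite distrC.
Unshelve. all: by end_near.
Qed.

End CountConvergence.

Theorem theorem10p5 (R : realType) (disp : measure_display)
    (T : measurableType disp) (P : probability T R) (S : finType)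
    (p : S -> S -> R) (pi : S -> R) (M : nat -> T -> S)
    (hM : markov_chain P p M) (hirr : irreducible p) (haper : aperiodic p)
    (hpi : stationary p pi) (hM0 : initial_law P pi M)
    (d : nat) (u : d.-tuple (seq S))
    (sigma : R) (hsigma : 0 <= sigma)
    (hvar : variance_asymptotics P M u sigma) :
  cvg_in_distribution P (normalized_count P M u) (centered_gaussian sigma).
Proof.
have [p_stoch _ _] := hM; have [_ pi1 _] := hpi.
(* A state exists because [pi] has total mass 1; it serves as the default letter. *)
have [s0 _|S0] := pickP (fun s : S => true); last first.
  by exfalso; move: pi1; rewrite big_pred0// => /esym/eqP; rewrite oner_eq0.
pose a N : R := N%:R `^ (d%:R - 2^-1).
pose Y N := centered_count p pi u N.+1 (a N).
have mean F N := expectation_random_word hM hM0 s0 F N.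
have YE N : normalized_count P M u N = (fun t => Y N (random_word M N t)).
  apply/funext => t; rewrite /normalized_count /Y /centered_count.
  have := mean (fun x => (occurrences u x)%:R) N.
  by rewrite /occ_count => ->.
pose v N := chain_mean p pi N.+1 (fun x => Y N x ^+ 2).
have v_var N : (0 < N)%N ->
    fine ('V_P[occ_count R M u N])%E = v N * N%:R `^ (2 * d%:R - 1).
  move=> N0; have aN : a N != 0 by apply: lt0r_neq0; apply: powR_gt0; rewrite ltr0n.
  pose F x : R := (occurrences u x)%:R - chain_mean p pi N.+1 (fun y => (occurrences u y)%:R).
  have -> : ('V_P[occ_count R M u N] = 'E_P[fun t => (F (random_word M N t) ^+ 2)%R])%E.
    rewrite /variance covariance.unlock; congr ('E_P[_])%E; apply/funext => t.
    have := mean (fun x => (occurrences u x)%:R) N.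
    by rewrite /occ_count /F /= => ->; rewrite expr2.
  rewrite (mean (fun x => F x ^+ 2)) /= /v mulrC -powR_scale_sqr -chain_meanZl.
  apply: eq_chain_mean => x _; rewrite /Y /centered_count expr_div_n mulrC.
  by rewrite divfK// expf_neq0.
(* Dividing the [O(N^(2d-2))] error by [N^(2d-1)] leaves at most [(K0 + 1) / N]. *)
have v_cvg : v N @[N --> \oo] --> sigma ^+ 2.
  move/eqOP : hvar => [K0 [_ hK]].
  have near_var := hK (K0 + 1) (ltr_pwDr ltr01 (lexx _)).
  apply/cvgrPdist_le => e e0; near=> N.
  have N0 : (0 < N)%N by near: N; exact: nbhs_infty_gt.
  have N0' : 0 < (N%:R : R) by rewrite ltr0n.
  have pow0 : 0 < (N%:R : R) `^ (2 * d%:R - 1) by rewrite powR_gt0.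
  have : `|fine ('V_P[occ_count R M u N])%E - sigma ^+ 2 * N%:R `^ (2 * d%:R - 1)| <=
      (K0 + 1) * `|(N%:R : R) `^ (2 * d%:R - 2)| by near: N.
  rewrite v_var// -mulrBl normrM (gtr0_norm pow0) -ler_pdivlMr//.
  have -> : (N%:R : R) `^ (2 * d%:R - 2) = N%:R `^ (2 * d%:R - 1) / N%:R.
    have powB : (N%:R : R) `^ (2 * d%:R - 1 - 1) = N%:R `^ (2 * d%:R - 1) / N%:R `^ 1.
      by apply: powRB; rewrite (gt_eqF N0') implybT.
    by rewrite powRr1// in powB; rewrite -powB; congr powR; ring.
  rewrite normrM (gtr0_norm pow0) normfV (gtr0_norm N0').
  rewrite mulrA mulrAC mulfK ?gt_eqF// distrC => /le_trans; apply.
  rewrite ler_pdivrMr// mulrC -ler_pdivrMr//.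
  near: N; exact: nbhs_infty_ger.
apply: (@cos_cvg_in_distribution _ _ _ _ _ _ (sigma ^+ 2 + 1)).
- by move=> N; rewrite YE; exact: (measurable_random_word hM s0).
- move/cvgrPdist_le: v_cvg => /(_ 1 ltr01); apply: filterS => N.
  rewrite YE => vN; have := mean (fun x => Y N x ^+ 2) N.
  rewrite unlock => ->; rewrite lee_fin -/(v N).
  by move: vN; rewrite ler_norml; lra.
- move=> t b.
  have -> : \int[centered_gaussian sigma]_x cos (t * x + b) =
      cos b * expR (- (sigma ^+ 2 * t ^+ 2 / 2)).
    (* For [sigma = 0] the limit is the Dirac mass at 0, and both sides equal [cos b]. *)
    rewrite /centered_gaussian; case: eqVneq => [->|s_neq0].
      rewrite expr0n /= !mul0r oppr0 expR0 mulr1 /Rintegral integral_dirac//=.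
        by rewrite indicT mul1r mulr0 add0r.
      apply/measurable_EFinP; apply: measurableT_comp.
        exact: continuous_measurable_fun (@continuous_cos R).
      by apply: measurable_funD => //; exact: measurable_funM.
    exact: Rintegral_cos_normal_prob.
  have := @cvg_chain_mean_cos _ _ _ _ p_stoch hirr haper hpi s0 d u sigma t b v_cvg.
  have /funext -> // : forall N, \int[P]_x cos (t * normalized_count P M u N x + b) =
      chain_mean p pi N.+1 (fun x => cos (t * Y N x + b)).
  move=> N; rewrite YE; have := mean (fun x => cos (t * Y N x + b)) N.
  by rewrite unlock /Rintegral => ->.
Unshelve. all: by end_near.
Qed.
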